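(* Let the base space $\mathcal{X}$ be locally compact and second countable, and such that $\mathcal{K}_\Phi:\mathcal{X}\times\mathcal{X}\to\mathbb{R}$ is measurable. Let $Y$ be a closed subset of $\mathbb{R}$ and $\tilde\mu$ a probability measure on $\mathcal{X}\times Y$. Let $p\in[1,+\infty)$ and suppose $$\int_{\mathcal{X}\times Y}\mathcal{K}_\Phi(x,x)^{p/2}\,d\tilde\mu(x,y)<+\infty .$$ Then for any $p$-loss function $V$ with respect to $\tilde\mu$ and any $\lambda>0$, $$\arg\min_{F\in\mathcal{H}_K}\left\{\int_{\mathcal{X}\times Y}V\Big(\int_0^T\langle F(\psi(x)|_{[0,t]}),d\boldsymbol{\xi}(x)_t\rangle_{\mathcal{H}_\xi},\,y\Big)d\tilde\mu(x,y)+\frac\lambda2\|F\|^2_{\mathcal{H}_K}\right\}$$ $$=\arg\min_{F\in\mathcal{H}_\Phi}\left\{\int_{\mathcal{X}\times Y}V\big(\langle F,\Phi_x\rangle_{\mathcal{H}_\Phi},\,y\big)d\tilde\mu(x,y)+\frac\lambda2\|F\|^2_{\mathcal{H}_\Phi}\right\},$$ and $F^*\in\mathcal{H}_\Phi$ belongs to this set if and only if there is $\alpha^*\in L^q_{\tilde\mu}(\mathcal{X}\times Y)$, with $\frac1p+\frac1q=1$, such that $$\alpha^*(x,y)\in\partial_1V(ev^\Phi_xF^*,y)\quad\text{for }\tilde\mu\text{-a.e. }(x,y),$$ $$ev^\Phi_xF^*=-\frac1\lambda\int_{\mathcal{X}\times Y}\mathcal{K}_\Phi(x,x')\,\alpha^*(x',y)\,d\tilde\mu(x',y)\quad\text{for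 all }x\in\mathcal{X}.$$ In that case, for all $z\in\mathcal{H}_\xi$ and $s\in\mathcal{S}$, $$\langle ev^K_sF^*,z\rangle_{\mathcal{H}_\xi}=\langle F^*,K(s,\cdot)z\rangle_{\mathcal{H}_K}=-\frac1\lambda\int_{\mathcal{X}\times Y}\langle\Phi_{x'},K(s,\cdot)z\rangle_{\mathcal{H}_K}\,\alpha^*(x',y)\,d\tilde\mu(x',y),$$ i.e. $$\langle ev^K_sF^*,z\rangle_{\mathcal{H}_\xi}=-\frac1\lambda\int_{\mathcal{X}\times Y}\alpha^*(x',y)\left(\int_0^T\langle K(s,\psi(x')|_{[0,t]})z,d\boldsymbol{\xi}(x')_t\rangle_{\mathcal{H}_\xi}\right)d\tilde\mu(x',y).$$
   Context: Setting. $T>0$, $\alpha\in(0,1)$, $N=\lfloor1/\alpha\rfloor$. $\mathcal{X}$ is the base space (a measurable space; with Borel $\sigma$-algebra when topological). $\mathcal{G}_\psi$ is a topological vector space and $\psi:\mathcal{X}\to C^0([0,T];\mathcal{G}_\psi)$ a feature extractor. $\mathcal{H}_\xi$ is a finite-dimensional real inner product space, and to each $x\in\mathcal{X}$ is associated an $\alpha$-Hölder rough path $\boldsymbol{\xi}(x)=(1,\xi^1(x),\dots,\xi^N(x)):\{0\le s\le t\le T\}\to T^{(N)}(\mathcal{H}_\xi)=\bigoplus_{m=0}^N\mathcal{H}_\xi^{\otimes m}$ (Chen's relation $\boldsymbol\xi_{s,u}\otimes\boldsymbol\xi_{u,t}=\boldsymbol\xi_{s,t}$ and $\|\xi^m_{s,t}\|\le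 C|t-s|^{m\alpha}$). Let $\mathcal{S}=\bigcup_{s\in[0,T]}C^0([0,s];\mathcal{G}_\psi)$ and let $K:\mathcal{S}\times\mathcal{S}\to\mathcal{L}(\mathcal{H}_\xi)$ be an operator-valued kernel: $K(u,v)=K(v,u)^T$ and all matrices $(\langle K(u_i,u_j)z_i,z_j\rangle)_{i,j}$ are positive semidefinite. Its RKHS $\mathcal{H}_K\subseteq\{\mathcal{S}\to\mathcal{H}_\xi\}$ is the Hilbert closure of the span of the $K(u,\cdot)z$, with $\langle F,K(u,\cdot)z\rangle_{\mathcal{H}_K}=\langle F(u),z\rangle_{\mathcal{H}_\xi}$; $ev^K_uF=F(u)$. Standing assumption: for every $x\in\mathcal{X}$ there is a given path $\boldsymbol{K}(x)=(K^0(x),\dots,K^{N-1}(x)):[0,T]\to\bigoplus_{m=0}^{N-1}\mathcal{L}(\mathcal{H}_\xi^{\otimes m};\mathcal{L}(\mathcal{H}_\xi;\mathcal{H}_K))$ with $K^0(x)_s=K(\psi(x)|_{[0,s]},\cdot)$ and a constant $C$ such that for all $0\le m\le N-1$, $0\le s\le t\le T$: $\|K^m(x)_t-\boldsymbol{K}(x)_s[\boldsymbol\xi(x)_{s,t}\otimes(\cdot)]\|\le C|t-s|^{(N-m)\alpha}$ and $\|K^m(x)_t-K^m(x)_s\|\le C|t-s|^\alpha$, where $\boldsymbol{K}(x)_s[\boldsymbol\xi(x)_{s,t}\otimes v]=\sum_{k=0}^{N-1-m}K^{m+k}(x)_s[\xi^k(x)_{s,t}\otimes v]$ for $v\in\mathcal{H}_\xi^{\otimes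 m}$. Using $\mathcal{L}(\mathcal{H}_\xi^{\otimes m};\mathcal{L}(\mathcal{H}_\xi;\mathcal{H}_K))\hookrightarrow\mathcal{L}(\mathcal{H}_\xi^{\otimes m+1};\mathcal{H}_K)$, define (limits over partitions of $[0,T]$, which exist) $\Phi_x=\int_0^TK(\psi(x)|_{[0,t]},\cdot)\,d\boldsymbol\xi(x)_t=\lim_{|\mathcal{P}|\to0}\sum_{[s,t]\in\mathcal{P}}\sum_{m=0}^{N-1}K^m(x)_s[\xi^{m+1}(x)_{s,t}]\in\mathcal{H}_K$, and for $F\in\mathcal{H}_K$, $\int_0^T\langle F(\psi(x)|_{[0,t]}),d\boldsymbol\xi(x)_t\rangle_{\mathcal{H}_\xi}=\lim_{|\mathcal{P}|\to0}\sum_{[s,t]\in\mathcal{P}}\sum_{m=0}^{N-1}\langle F,K^m(x)_s[\xi^{m+1}(x)_{s,t}]\rangle_{\mathcal{H}_K}=\langle F,\Phi_x\rangle_{\mathcal{H}_K}$. In particular $\int_0^T\langle K(s,\psi(x)|_{[0,t]})z,d\boldsymbol\xi(x)_t\rangle$ is this integral for $F=K(s,\cdot)z$. $\mathcal{K}_\Phi(x,\tilde x)=\langle\Phi_x,\Phi_{\tilde x}\rangle_{\mathcal{H}_K}$; its RKHS $\mathcal{H}_\Phi$ is identified with the closure of $\mathrm{Span}\{\Phi_x:x\in\mathcal{X}\}$ in $\mathcal{H}_K$ with the inherited inner product, and $ev^\Phi_xF=\langle F,\Phi_x\rangle_{\mathcal{H}_K}\in\mathbb{R}$. A function $V:\mathbb{R}\times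 Y\to[0,+\infty)$ is a $p$-loss function with respect to $\tilde\mu$ if: $V(\cdot,y)$ is convex for every $y\in Y$; $V$ is measurable; and there are $b\ge0$ and $a:Y\to[0,+\infty)$ with $V(w,y)\le a(y)+b|w|^p$ for all $(w,y)\in\mathbb{R}\times Y$ and $\int_{\mathcal{X}\times Y}a(y)\,d\tilde\mu(x,y)<+\infty$. $\partial_1V$ denotes the convex subdifferential in the first variable. *)

(* Defs.v *)
From HB Require Import structures.
From mathcomp Require Import all_boot all_order all_algebra.
From mathcomp Require Import sesquilinear.
From mathcomp Require Import all_classical all_reals all_analysis.
Set Implicit Arguments.
Unset Strict Implicit.
Unset Printing Implicit Defensive.
Import Order.TTheory GRing.Theory Num.Theory.
Import numFieldNormedType.Exports.
Local Open Scope classical_set_scope.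
Local Open Scope ring_scope.

Section Paths.
Context {R : realType}.

(* C^0([0,s]; G). The domain is a subtype, so two paths are equal as soon as
   they agree on [0,s]. *)
Record path_on (G : topologicalType) (s : R) := PathOn {
  path_fun :> set_type `[0, s]%classic -> G ;
  path_cts : continuous path_fun }.

(* The (disjoint) union of the C^0([0,s]; G) for s in [0,T]. *)
Definition stopped_path (G : topologicalType) (T : R) :=
  {s : set_type `[0, T]%classic & path_on G (set_val s)}.

Context {G : topologicalType} {T : R}.

Lemma sub_horizon (s : set_type `[0, T]%classic) :
  `[0, set_val s]%classic `<=` `[0, T]%classic.
Proof.
move=> r /=; rewrite !in_itv /= => /andP[-> rs] /=.
have /set_mem : set_val s \in `[0, T]%classic by exact: valP.
by rewrite /= in_itv /= => /andP[_]; exact: le_trans.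
Qed.

Lemma restrict_cts (g : path_on G T) (s : set_type `[0, T]%classic) :
  continuous (path_fun g \o subfun (@sub_horizon s)).
Proof.
move=> r; apply: continuous_comp; last exact: path_cts.
move: r; apply: (@continuous_comp_initial _ _ _
  (set_val : set_type `[0, T]%classic -> R)).
exact: initial_continuous.
Qed.

Definition path_restrict (g : path_on G T) (s : set_type `[0, T]%classic) :
    stopped_path G T :=
  existT _ s (PathOn (@restrict_cts g s)).

End Paths.

Section Partitions.
Context {R : realType}.
Implicit Types (T d : R) (P : seq R).

(* An [itv_partition 0 T P] lists the points after 0; its points are 0 :: P. *)
Definition mesh_lt P d := forall i, (i < size P)%N ->
  nth 0 (0 :: P) i.+1 - nth 0 (0 :: P) i < d.

(* The filter "|P| -> 0" on the partitions of [0,T]. *)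
Definition mesh_to0 T : set_system (seq R) :=
  [set A | exists2 d : R, 0 < d &
    forall P, itv_partition 0 T P -> mesh_lt P d -> A P].

Definition germ_sum {V : normedModType R} (g : R -> R -> V) P : V :=
  \sum_(i < size P) g (nth 0 (0 :: P) i) (nth 0 (0 :: P) i.+1).

Definition germ_lim {V : normedModType R} T (g : R -> R -> V) : V :=
  lim (germ_sum g @ mesh_to0 T).

End Partitions.

(* For an inner product space H with orthonormal basis e_0, ..., e_{n-1}, an
   element of the m-th tensor power of H is given by its coordinates in the
   orthonormal basis (e_{w_0} (x) ... (x) e_{w_{m-1}}), w ranging over the words
   of length m. *)
Section Tensors.
Context {R : realType} {n : nat}.

Definition tens (m : nat) := {ffun m.-tuple 'I_n -> R^o}.

Definition tnorm m (u : tens m) : R := Num.sqrt (\sum_w u w ^+ 2).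

Definition tone : tens 0 := [ffun=> 1].

Definition tcoef m (u : tens m) (w : seq 'I_n) : R :=
  if insub w is Some w' then u w' else 0.

(* u (x) v, with the degree of the result left free to avoid casts; it is meant
   to be used with m equal (but not necessarily convertible) to k + l, and is 0
   otherwise. *)
Definition tmul k l m (u : tens k) (v : tens l) : tens m :=
  [ffun w : m.-tuple 'I_n => tcoef u (take k w) * tcoef v (drop k w)].

(* The t_i in the decomposition t = \sum_i t_i (x) e_i. *)
Definition tslice m (t : tens m.+1) (i : 'I_n) : tens m :=
  [ffun w : m.-tuple 'I_n => t [tuple of rcons w i]].

(* The embedding of L(H^(x)m; L(H; V)) into L(H^(x)(m+1); V). *)
Definition tapply {H : Type} {V : zmodType} (e : n.-tuple H) m
    (A : tens m -> H -> V) (t : tens m.+1) : V :=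
  \sum_(i < n) A (tslice t i) (tnth e i).

End Tensors.
Arguments tens : clear implicits.
Arguments tmul {R n k l m}.

Section RoughPaths.
Context {R : realType} {n : nat}.

Definition rough_level (alpha : R) : nat := Num.truncn (1 / alpha).

(* Only the levels m <= N and the times 0 <= s <= t <= T are relevant. *)
Record rough_path (T alpha : R) (xi : forall m, R -> R -> tens R n m) : Prop := {
  rough_level0 : forall s t, 0 <= s -> s <= t -> t <= T -> xi 0%N s t = tone ;
  rough_chen : forall m s u t, (m <= rough_level alpha)%N ->
    0 <= s -> s <= u -> u <= t -> t <= T ->
    xi m s t = \sum_(k < m.+1) tmul (xi k s u) (xi (m - k)%N u t) ;
  rough_holder : exists C : R, forall m s t, (m <= rough_level alpha)%N ->
    0 <= s -> s <= t -> t <= T ->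
    tnorm (xi m s t) <= C * (t - s) `^ (m%:R * alpha) }.

End RoughPaths.

Section Hilbert.
Context {R : realType}.

Record hilbertSpace := HilbertSpace {
  hilbert_sort :> completeNormedModType R ;
  hdot : {dot hilbert_sort for idfun} ;
  hdotE : forall F, hdot F F = `|F| ^+ 2 }.

Definition lspan {V : lmodType R} (A : set V) : set V :=
  [set v | exists k (c : 'I_k -> R) (w : 'I_k -> V),
     (forall i, A (w i)) /\ v = \sum_(i < k) c i *: w i].

Definition argmin {V : Type} (D : set V) (J : V -> \bar R) : set V :=
  [set F | D F /\ forall F', D F' -> (J F <= J F')%E].

Definition subdiff (f : R -> R) (w : R) : set R :=
  [set g | forall w', f w + g * (w' - w) <= f w'].

End Hilbert.
Arguments hilbertSpace : clear implicits.
Arguments hdot {R h}.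

Section Kernels.
Context {R : realType} {S : Type} {H : vectType R} (dotH : {dot H for idfun}).

Record op_kernel (K : S -> S -> 'End(H)) : Prop := {
  op_kernel_sym : forall u v z w, dotH (K u v z) w = dotH z (K v u w) ;
  op_kernel_psd : forall k (u : 'I_k -> S) (z : 'I_k -> H) (c : 'I_k -> R),
    0 <= \sum_(i < k) \sum_(j < k) c i * c j * dotH (K (u i) (u j) (z i)) (z j) }.

(* The reproducing kernel Hilbert space of K: a Hilbert space of functions
   S -> H ([rk_fun] is the inclusion), in which the K(u,.)z, u in S, z in H,
   are total and reproducing. It is unique up to a unitary map compatible with
   [rk_fun]. *)
Record rkhs (K : S -> S -> 'End(H)) := Rkhs {
  rk_space :> hilbertSpace R ;
  rk_fun : {linear rk_space -> (S -> H)} ;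
  rk_fun_inj : injective rk_fun ;
  rk_sec : S -> {linear H -> rk_space} ;
  rk_secE : forall u z v, rk_fun (rk_sec u z) v = K u v z ;
  rk_dense : closure (lspan [set F | exists u z, F = rk_sec u z]) = setT ;
  rk_repr : forall F u z, hdot F (rk_sec u z) = dotH (rk_fun F u) z }.

End Kernels.

Section RoughIntegrals.
Context {R : realType} {n : nat} {H : vectType R} (dotH : {dot H for idfun}).
Context {V : hilbertSpace R} (e : n.-tuple H) (T alpha : R).
Local Notation N := (rough_level alpha).

(* A path in the sum over m < N of L(H^(x)m; L(H; V)), written as bilinear
   maps. A bound on an operator norm is spelt out on the arguments. *)
Definition controlled_path (xi : forall m, R -> R -> tens R n m)
    (A : forall m, R -> {bilinear tens R n m -> H -> V}) : Prop :=
  exists C : R, forall m s t, (m < N)%N -> 0 <= s -> s <= t -> t <= T ->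
    (forall (v : tens R n m) (h : H),
      `|A m t v h - \sum_(k < N - m) A (m + k)%N s (tmul (xi k s t) v) h|
        <= C * (t - s) `^ ((N - m)%:R * alpha) * tnorm v * Num.sqrt (dotH h h)) /\
    (forall (v : tens R n m) (h : H),
      `|A m t v h - A m s v h|
        <= C * (t - s) `^ alpha * tnorm v * Num.sqrt (dotH h h)).

Context (xi : forall m, R -> R -> tens R n m).
Context (A : forall m, R -> {bilinear tens R n m -> H -> V}).

Definition rough_int : V :=
  germ_lim T (fun s t => \sum_(m < N) tapply e (A m s) (xi m.+1 s t)).

(* The integral of <F, dxi>, where A is the lift of the kernel sections. *)
Definition rough_pair (F : V) : R :=
  germ_lim (V := R^o) T
    (fun s t => \sum_(m < N) hdot F (tapply e (A m s) (xi m.+1 s t))).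

End RoughIntegrals.

(* X with its Borel sigma-algebra. *)
Definition borel (X : ptopologicalType) := g_sigma_algebraType (@open X).

Section Learning.
Context {R : realType} {X : ptopologicalType}.
Context (mu : {measure set (borel X * R) -> \bar R}) (Y : set R).

(* V is only constrained on R x Y. *)
Record is_loss (p : R) (V : R -> R -> R) : Prop := {
  loss_ge0 : forall w y, Y y -> 0 <= V w y ;
  loss_convex : forall y, Y y ->
    convex_function [set: R^o] (fun w : R^o => V w y : R^o) ;
  loss_measurable :
    measurable_fun ([set: R] `*` Y) (fun wy : R * R => V wy.1 wy.2) ;
  loss_growth : exists (b : R) (a : R -> R),
    [/\ 0 <= b, forall y, Y y -> 0 <= a y,
        forall w y, Y y -> V w y <= a y + b * `|w| `^ p &
        mu.-integrable ([set: borel X] `*` Y)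
          (fun z : borel X * R => (a z.2)%:E)] }.

Definition reg_risk {V : normedModType R} (L : R -> R -> R) (lambda : R)
    (pred : V -> X -> R) (F : V) : \bar R :=
  (\int[mu]_(z in [set: borel X] `*` Y) (L (pred F z.1) z.2)%:E
   + (lambda / 2 * `|F| ^+ 2)%:E)%E.

End Learning.

(* Main.v *)
(* By Chen's relation and the controlled-path bound, the germ of the rough
   integral is additive up to O(|t-s|^((N+1) alpha)) with (N+1) alpha > 1, so its
   Riemann sums converge and the scalar integral of F is <F, Phi_x>. The risk thus
   depends only on the projection of F to H_Phi, whence the equality of argmins.

   The measurable selections of the subdifferential of the loss along a minimiser
   F form a convex set; the growth condition bounds them by a multiple of
   (a + |ev F|^p + 1)^(1/q), which lies in L^q and is integrable against |Phi|.
   Each selection therefore has a weak integral in H_K against Phi. Let u be the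
   weak integral closest to v = - lambda F, and G = v - u. First-order optimality
   of F in the direction G yields a selection with weak integral u' such that
   <G, v> <= <G, u'>, and <G, u'> <= <G, u> because u is closest. Hence
   |G|^2 = <G, v - u> <= 0. The converse is the subgradient inequality. *)

Require Import Defs.
From HB Require Import structures.
From mathcomp Require Import all_boot all_order all_algebra.
From mathcomp Require Import sesquilinear.
From mathcomp Require Import all_classical all_reals all_analysis.
From mathcomp Require Import measurable_realfun ess_sup_inf.
From mathcomp Require Import lra ring.
Set Implicit Arguments.
Unset Strict Implicit.
Unset Printing Implicit Defensive.
Import Order.TTheory GRing.Theory Num.Theory.
Import numFieldNormedType.Exports.
Local Open Scope classical_set_scope.
Local Open Scope ring_scope.

(** * Inner product spaces and the Riesz representation *)

(** [Phi] is only known to be measurable through the kernel: its norm and its pairings with vectors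
    are measurable, which is what the Riesz representation needs to produce weak integrals. The
    obstacle is that [- lambda F] must be the weak integral of an actual selection, not a limit of
    such integrals: their set is convex, but its closedness is not evident. The argument on
    near-minimisers is therefore stated for an abstract functional and used twice, once for Riesz
    and once to choose selections which themselves converge almost everywhere. Projection onto the
    convex set of weak integrals then does the work of a separation theorem, and the subdifferential
    of the integral functional is never computed. Selections are built as limits of difference
    quotients, so they are measurable by construction. Dividing them by their growth bound makes
    them bounded, so that L2 arguments apply for every [p], including [p = 1] with [q] infinite. *)

Section HilbertTheory.
Context {R : realType} {V : hilbertSpace R}.
Implicit Types F G : V.

Lemma hdotC F G : hdot F G = hdot G F.
Proof. by rewrite hermC expr0 mul1r. Qed.

Lemma hdotDl F G K : hdot (F + G) K = hdot F K + hdot G K.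
Proof. exact: linearDl. Qed.

Lemma hdotDr F G K : hdot F (G + K) = hdot F G + hdot F K.
Proof. exact: linearDr. Qed.

Lemma hdotNr F G : hdot F (- G) = - hdot F G.
Proof. exact: linearNr. Qed.

Lemma hdotBl F G K : hdot (F - G) K = hdot F K - hdot G K.
Proof. exact: linearBl. Qed.

Lemma hdotBr F G K : hdot F (G - K) = hdot F G - hdot F K.
Proof. exact: linearBr. Qed.

Lemma hdotZl c F G : hdot (c *: F) G = c * hdot F G.
Proof. exact: linearZl_LR. Qed.

Lemma hdotZr c F G : hdot F (c *: G) = c * hdot F G.
Proof. by rewrite hdotC hdotZl hdotC. Qed.

Lemma hdot_suml k (F : 'I_k -> V) G :
  hdot (\sum_i F i) G = \sum_i hdot (F i) G.
Proof. exact: linear_sumlz. Qed.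

Lemma hdot_sumr k F (G : 'I_k -> V) :
  hdot F (\sum_i G i) = \sum_i hdot F (G i).
Proof. exact: linear_sumr. Qed.

Lemma hdot0l F : hdot 0 F = 0.
Proof. exact: linear0l. Qed.

Lemma hnorm_addZ F G t :
  `|F + t *: G| ^+ 2 = `|F| ^+ 2 + 2 * t * hdot F G + t ^+ 2 * `|G| ^+ 2.
Proof.
rewrite -!hdotE hdotDl !hdotDr !hdotZl !hdotZr (hdotC G F).
by ring.
Qed.

Lemma parallelogram F G :
  `|F - G| ^+ 2 = 2 * `|F| ^+ 2 + 2 * `|G| ^+ 2 - 4 * `|2^-1 *: (F + G)| ^+ 2.
Proof.
rewrite -!hdotE hdotBl !hdotBr !hdotZl !hdotZr !hdotDl !hdotDr (hdotC G F).
by field.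
Qed.

Lemma hdot_le F G : `|hdot F G| <= `|F| * `|G|.
Proof.
have [->|F0] := eqVneq F 0; first by rewrite hdot0l !normr0 mul0r.
have NF : 0 < `|F| ^+ 2 by rewrite exprn_gt0// normr_gt0.
rewrite -(@ler_pXn2r _ 2)// ?nnegrE ?mulr_ge0//.
have : 0 <= `|G + (- (hdot F G / `|F| ^+ 2)) *: F| ^+ 2 by rewrite exprn_ge0.
rewrite hnorm_addZ (hdotC G F) -(ler_pM2l NF 0) mulr0 real_normK ?num_real//.
set d := hdot F G; set a := `|F| ^+ 2; set b := `|G| ^+ 2.
suff -> : a * (b + 2 * - (d / a) * d + (- (d / a)) ^+ 2 * a) =
   a * b - d ^+ 2 by rewrite exprMn subr_ge0.
by field; rewrite gt_eqF.
Qed.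

Lemma hdot_cvgr (I : Type) (B : set_system I) {FB : Filter B} (f : I -> V) F G :
  f @ B --> F -> (fun i => hdot G (f i)) @ B --> hdot G F.
Proof.
move=> fF; apply/cvgrPdist_le => /= eps eps0.
have d0 : 0 < eps / (`|G| + 1) by rewrite divr_gt0// ltr_wpDl.
near=> i.
rewrite -hdotBr (le_trans (hdot_le _ _))//.
have : `|F - f i| <= eps / (`|G| + 1).
  by near: i; move/cvgrPdist_le : fF; exact.
rewrite ler_pdivlMr ?ltr_wpDl// => h; rewrite mulrC (le_trans _ h)//.
by rewrite ler_wpM2l// lerDl.
Unshelve. all: by end_near. Qed.

End HilbertTheory.

Section NearMinimizers.
Context {R : realType}.

Definition midgap (T : Type) (q : T -> R) (mid : T -> T -> T) (x y : T) :=
  2 * q x + 2 * q y - 4 * q (mid x y).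

(* For a squared norm [q] this is the fact that near-minimisers of the norm on
   a decreasing sequence of convex sets are Cauchy; [midgap q mid x y] is then
   the squared distance, by the parallelogram identity. *)
Lemma near_minimizers (T : Type) (q : T -> R) (mid : T -> T -> T)
    (C : nat -> set T) (L U : R) :
  (forall n m, (n <= m)%N -> C m `<=` C n) ->
  (forall n x y, C n x -> C n y -> C n (mid x y)) ->
  (forall x, C 0%N x -> L <= q x) ->
  (forall n, exists2 x, C n x & q x <= U) ->
  exists x : nat -> T,
    [/\ forall n, C n (x n),
        forall n y, C n y -> q (x n) <= q y + n.+1%:R^-1 &
        forall eps : R, 0 < eps -> exists N, forall n k, (N <= n)%N -> (N <= k)%N ->
          midgap q mid (x n) (x k) < eps].
Proof.
move=> Cdec Cmid CL CU.
pose m n := inf (q @` C n).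
have lbC n : has_lbound (q @` C n).
  by exists L => _ [x Cx <-]; apply: CL; exact: Cdec Cx.
have neC n : (q @` C n) !=set0 by have [x Cx _] := CU n; exists (q x), x.
have mlb n y : C n y -> m n <= q y.
  by move=> Cy; apply: ge_inf; [exact: lbC|exists y].
have mU n : m n <= U.
  by have [x Cx qx] := CU n; exact: le_trans (mlb _ _ Cx) qx.
have mnd : nondecreasing_seq m.
  move=> n k nk; apply: lb_le_inf; first exact: neC.
  by move=> _ [x Cx <-]; apply: mlb; exact: Cdec Cx.
have mcvg : cvgn m by apply: nondecreasing_is_cvgn => //; exists U => _ [n _ <-].
have xP n : exists x, C n x /\ q x <= m n + n.+1%:R^-1.
  have [_ [x Cx <-] qx] : exists2 e, (q @` C n) e & e < m n + n.+1%:R^-1.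
    apply: inf_adherent; first by rewrite invr_gt0.
    by split; [exact: neC|exact: lbC].
  by exists x; split => //; exact: ltW.
have [x xC] := choice xP.
exists x; split.
- by move=> n; have [] := xC n.
- move=> n y Cy; have [_ /le_trans] := xC n; apply.
  by rewrite lerD2r; exact: mlb.
- move=> eps eps0.
  (* Each of the two values is at most [limn m + 2 * (eps / 16)] by a crude count, in fact
     [limn m + eps / 16], and the midpoint value is at least [limn m - eps / 16]; the gap is then at
     most [8 * (eps / 16)]. *)
  have e8 : 0 < eps / 16 by rewrite divr_gt0.
  have /cvgrPdist_le /(_ _ e8)[N1 _ N1P] : m @ \oo --> limn m by [].
  have mlim n : m n <= limn m by exact: nondecreasing_cvgn_le.
  have /cvgrPdist_le /(_ _ e8)[N2 _ N2P] := @cvg_harmonic R.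
  exists (maxn N1 N2).
  (* Both orders of the pair are treated under [n <= k], since [mid] is not assumed symmetric and
     the lower bound on the midpoint needs both points in [C n]. *)
  have main n k : (maxn N1 N2 <= n)%N -> (n <= k)%N ->
      midgap q mid (x n) (x k) < eps /\ midgap q mid (x k) (x n) < eps.
    move=> Nn nk.
    have Nk := leq_trans Nn nk.
    have [Cn qn] := xC n; have [Ck qk] := xC k.
    have Ck' := Cdec _ _ nk _ Ck.
    have g1 := mlb _ _ (Cmid _ _ _ Cn Ck').
    have g2 := mlb _ _ (Cmid _ _ _ Ck' Cn).
    move: Nn Nk; rewrite !geq_max => /andP[N1n N2n] /andP[N1k N2k].
    have := N2P _ N2n; have := N2P _ N2k; have := N1P _ N1n; have := N1P _ N1k.
    rewrite /harmonic/= !sub0r !normrN !ger0_norm ?subr_ge0//.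
    have := mlim n; have := mlim k.
    rewrite /midgap.
    move: (q _) (q _) (q _) (q _) qn qk g1 g2 => a b c d.
    move: (m n) (m k) (limn m) (n.+1%:R^-1) (k.+1%:R^-1) => mn mk ml hn hk.
    by move=> *; split; lra.
  move=> n k Nn Nk; have [nk|/ltnW kn] := leqP n k.
    by have [] := main _ _ Nn nk.
  by have [] := main _ _ Nk kn.
Qed.

End NearMinimizers.

Section Riesz.
Context {R : realType} {V : hilbertSpace R}.
Implicit Types F G : V.

Lemma near_midgap_cvg (q : V -> R) (x : nat -> V) :
  (forall F G, `|F - G| ^+ 2 = midgap q (fun F G => 2^-1 *: (F + G)) F G) ->
  (forall eps : R, 0 < eps -> exists N, forall n k, (N <= n)%N -> (N <= k)%N ->
    midgap q (fun F G => 2^-1 *: (F + G)) (x n) (x k) < eps) ->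
  cvgn x.
Proof.
move=> qP xP; apply/cauchy_cvgP; apply: cauchy_exP => eps eps0.
have [N NP] := xP (eps ^+ 2) (exprn_gt0 2 eps0).
exists (x N); exists N => // n /= Nn.
rewrite /ball_ -ball_normE /ball_/=.
rewrite -(@ltr_pXn2r _ 2)// ?nnegrE ?(ltW eps0)//.
by rewrite qP; exact: NP.
Qed.

(* [u] minimises [|F|^2 - 2 l F] over [S]. *)
Lemma riesz (S : set V) (l : V -> R) (M : R) :
  closed S -> S 0 -> (forall a F G, S F -> S G -> S (a *: F + G)) ->
  (forall a F G, l (a *: F + G) = a * l F + l G) ->
  (forall F, `|l F| <= M * `|F|) ->
  exists2 u, S u & forall G, S G -> hdot G u = l G.
Proof.
move=> clS S0 Slin llin lM.
have l0 : l 0 = 0 by have := llin 1 0 0; rewrite scaler0 addr0; lra.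
have lD F G : l (F + G) = l F + l G.
  by have := llin 1 F G; rewrite scale1r mul1r.
have lZ a F : l (a *: F) = a * l F.
  by have := llin a F 0; rewrite l0 !addr0.
have SZ a F : S F -> S (a *: F).
  by move=> SF; have := Slin a F 0 SF S0; rewrite addr0.
have SD F G : S F -> S G -> S (F + G).
  by move=> SF SG; have := Slin 1 F G SF SG; rewrite scale1r.
pose q F : R := `|F| ^+ 2 - 2 * l F.
have qgap F G : `|F - G| ^+ 2 = midgap q (fun F G => 2^-1 *: (F + G)) F G.
  by rewrite parallelogram /midgap /q lZ lD; field.
have qL F : - M ^+ 2 <= q F.
  have := lM F; rewrite ler_norml => /andP[_].
  rewrite /q; have := normr_ge0 F; have : 0 <= (`|F| - M) ^+ 2 by exact: sqr_ge0.
  by nra.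
have q0 : q 0 <= 0 by rewrite /q normr0 l0 mulr0 subr0 expr0n.
(* The constant sequence of sets suffices here: only the infimum of [q] over [S] matters. *)
have [x [xS xmin xgap]] := @near_minimizers R V q (fun F G => 2^-1 *: (F + G))
   (fun=> S) (- M ^+ 2) 0 (fun _ _ _ => @subset_refl _ _)
   (fun _ F G SF SG => SZ _ _ (SD _ _ SF SG)) (fun F _ => qL F)
   (fun=> ex_intro2 _ _ 0 S0 q0).
have xcvg : cvgn x by exact: near_midgap_cvg xgap.
have qu : q (x n) @[n --> \oo] --> q (limn x).
  apply: cvgB.
    rewrite expr2; under eq_fun do rewrite expr2.
    by apply: cvgM; apply: cvg_norm.
  apply: cvgMr; apply/cvgrPdist_le => /= eps eps0.
  have d0 : 0 < eps / (`|M| + 1) by rewrite divr_gt0// ltr_wpDl.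
  near=> n.
  have -> : l (limn x) - l (x n) = l (limn x - x n).
    by rewrite lD -(scaleN1r (x n)) lZ mulN1r.
  rewrite (le_trans (lM _))//.
  have : `|limn x - x n| <= eps / (`|M| + 1).
    by near: n; move/cvgrPdist_le : xcvg; exact.
  rewrite ler_pdivlMr ?ltr_wpDl// => h.
  rewrite mulrC (le_trans _ h)// ler_wpM2l//.
  by rewrite (le_trans (ler_norm _))// lerDl.
have qmin y : S y -> q (limn x) <= q y.
  move=> Sy; apply/ler_addgt0Pr => eps eps0.
  apply: (@cvgr_to_le _ _ _ _ _ _ _ qu).
  near=> n; rewrite (le_trans (xmin n y Sy))// lerD2l.
  near: n.
  have /cvgrPdist_le /(_ _ eps0) := @cvg_harmonic R.
  by apply: filterS => n; rewrite /harmonic/= sub0r normrN ger0_norm.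
have Su : S (limn x).
  by apply: (closed_cvg _ clS _ _ xcvg) => //; exact: nearW.
exists (limn x) => // G SG.
set u := limn x in qmin Su *.
have key t : 0 <= t ^+ 2 * `|G| ^+ 2 + 2 * t * (hdot u G - l G).
  have := qmin _ (SD _ _ Su (SZ t _ SG)).
  by rewrite /q hnorm_addZ lD lZ; nra.
apply/eqP; rewrite hdotC -subr_eq0; apply/eqP.
set d := hdot u G - l G in key *.
have G1 : 0 < `|G| ^+ 2 + 1 by rewrite ltr_wpDl.
(* Nearly the minimiser of the quadratic in [t]; the added 1 keeps the denominator positive when [G]
   is 0. *)
have := key (- d / (`|G| ^+ 2 + 1)).
move: G1; set g := `|G| ^+ 2 => g1.
have -> : (- d / (g + 1)) ^+ 2 * g + 2 * (- d / (g + 1)) * d =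
   - (d ^+ 2 * (g + 2)) / (g + 1) ^+ 2 by field; rewrite gt_eqF.
have g0 : 0 <= g by exact: exprn_ge0.
rewrite pmulr_lge0 ?invr_gt0 ?exprn_gt0// oppr_ge0 pmulr_lle0; last by lra.
by move=> d2; apply/eqP; rewrite -sqrf_eq0 eq_le d2 sqr_ge0.
Unshelve. all: by end_near. Qed.

Lemma hilbert_projection (S : set V) F :
  closed S -> S 0 -> (forall a F G, S F -> S G -> S (a *: F + G)) ->
  exists2 P, S P & forall G, S G -> hdot G (F - P) = 0.
Proof.
move=> clS S0 Slin.
have [||P SP PE] := @riesz S (fun G => hdot G F) `|F| clS S0 Slin.
- by move=> a G K; rewrite hdotDl hdotZl.
- by move=> G; rewrite mulrC hdot_le.
by exists P => // G SG; rewrite hdotBr PE// subrr.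
Qed.

Lemma lspan_add (A : set V) a F G :
  lspan A F -> lspan A G -> lspan A (a *: F + G).
Proof.
move=> [k [c [w [Aw ->]]]] [k' [c' [w' [Aw' ->]]]].
exists (k + k')%N,
  (fun i : 'I_(k + k') =>
     match fintype.split i with inl j => a * c j | inr j => c' j end),
  (fun i : 'I_(k + k') =>
     match fintype.split i with inl j => w j | inr j => w' j end).
split.
  by move=> i; case: fintype.split.
rewrite big_split_ord/= scaler_sumr; congr (_ + _); apply: eq_bigr => i _.
  by rewrite (unsplitK (inl i)) scalerA.
by rewrite (unsplitK (inr i)).
Qed.

Lemma sub_lspan (A : set V) : A `<=` lspan A.
Proof.
move=> F AF; exists 1%N, (fun=> 1), (fun=> F); split => //.
by rewrite big_ord1 scale1r.
Qed.

Lemma closure_normP (A : set V) F :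
  closure A F <-> forall eps, 0 < eps -> exists2 G, A G & `|F - G| < eps.
Proof.
split=> [clF eps eps0|h B].
  have [G [AG]] := clF _ (nbhsx_ballx F eps eps0).
  by rewrite -ball_normE; exists G.
move=> /nbhs_ballP[eps /= eps0 FB]; have [G AG FG] := h _ eps0.
by exists G; split => //; apply: FB; rewrite -ball_normE.
Qed.

Lemma closure_seq (A : set V) F : closure A F ->
  exists2 x : nat -> V, (forall n, A (x n)) & x @ \oo --> F.
Proof.
move=> /closure_normP clF.
have h n : exists G, A G /\ `|F - G| < n.+1%:R^-1.
  by have [|G AG FG] := clF n.+1%:R^-1; [rewrite invr_gt0|exists G].
have [x xP] := choice h.
exists x => [n|]; first by have [] := xP n.
apply/cvgrPdist_lt => eps eps0; near=> n.
rewrite (lt_trans (xP n).2)//.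
near: n.
have /cvgrPdist_lt /(_ _ eps0) := @cvg_harmonic R.
by apply: filterS => n; rewrite /harmonic/= sub0r normrN ger0_norm.
Unshelve. all: by end_near. Qed.

Lemma closure_lspan_add (A : set V) a F G : closure (lspan A) F ->
  closure (lspan A) G -> closure (lspan A) (a *: F + G).
Proof.
move=> /closure_seq[x xA xF] /closure_seq[y yA yG].
have h : a *: x n + y n @[n --> \oo] --> a *: F + G.
  by apply: cvgD => //; exact: cvgZr.
apply: (closed_cvg _ (@closed_closure _ (lspan A)) _ _ h).
by apply: nearW => n; apply/subset_closure/lspan_add.
Qed.

Lemma closure_lspan_ortho (A : set V) F G : closure (lspan A) F ->
  (forall K, A K -> hdot G K = 0) -> hdot G F = 0.
Proof.
move=> /closure_seq[x xA xF] h.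
have hc : hdot G (x i) @[i --> \oo] --> hdot G F by exact: hdot_cvgr xF.
move: hc.
have -> : (fun i => hdot G (x i)) = cst 0.
  apply/funext => i; have [k [c [w [Aw ->]]]] := xA i.
  by rewrite hdot_sumr big1// => j _; rewrite hdotZr h ?mulr0.
move=> hc; rewrite -(cvg_lim (@norm_hausdorff _ R^o) hc).
by apply: (cvg_lim (@norm_hausdorff _ R^o)); exact: cvg_cst.
Qed.

End Riesz.

(** * The sewing lemma and rough integrals *)

Section Sewing.
Context {R : realType}.
Implicit Types (s t d : R) (P Q : seq R).

(** The starting point is an argument, so that sums over consecutive pieces of a partition can be
    cut and compared by induction. *)
Fixpoint chain_sum (V : zmodType) (g : R -> R -> V) s P : V :=
  if P is x :: P' then g s x + chain_sum g x P' else 0.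

Lemma germ_sumE (V : normedModType R) (g : R -> R -> V) P :
  germ_sum g P = chain_sum g 0 P.
Proof.
rewrite /germ_sum; suff h s : \sum_(i < size P)
    g (nth 0 (s :: P) i) (nth 0 (s :: P) i.+1) = chain_sum g s P by exact: h.
elim: P s => [s|x P IH s]; first by rewrite big_ord0.
by rewrite big_ord_recl/= -IH.
Qed.

Lemma chain_sum_cat (V : zmodType) (g : R -> R -> V) s P Q :
  chain_sum g s (P ++ Q) = chain_sum g s P + chain_sum g (last s P) Q.
Proof.
by elim: P s => [s|x P IH s]; rewrite /= ?add0r// IH addrA.
Qed.

Lemma path_le_last s P x : path <=%R s P -> x \in s :: P -> x <= last s P.
Proof.
elim: P s x => [s x _|y P IH s x /= /andP[sy yP]].
  by rewrite inE => /eqP ->.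
rewrite inE => /predU1P[->|/IH->//].
by rewrite (le_trans sy)// IH// mem_head.
Qed.

Lemma path_ge_head s P x : path <=%R s P -> x \in s :: P -> s <= x.
Proof.
rewrite path_sortedE; last exact: le_trans.
by move=> /andP[/allP sP _]; rewrite inE => /predU1P[->//|/sP].
Qed.

Lemma subseq_consP (A : eqType) (x : A) (P Q : seq A) : subseq (x :: P) Q ->
  exists Q1 Q2 : seq A, Q = Q1 ++ x :: Q2 /\ subseq P Q2.
Proof.
elim: Q => [//|y Q IH] /=; case: eqP => [<- PQ|_ /IH[Q1 [Q2 [-> PQ]]]].
  by exists [::], Q.
by exists (y :: Q1), Q2.
Qed.

Section Bounds.
Context {V : normedModType R} (g : R -> R -> V) (T C gamma : R).
Hypothesis C0 : 0 <= C.
Hypothesis gamma1 : 1 < gamma.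
Hypothesis almost_additive : forall s u t, 0 <= s -> s <= u -> u <= t -> t <= T ->
  `|g s t - g s u - g u t| <= C * (t - s) `^ gamma.

Let kappa := 2^-1 `^ (gamma - 1) : R.

(** The fixed point of [M = 2 * C + M * kappa]: bisection costs two defects of size [C], and each
    half contributes [M * kappa / 2]. *)
Definition sewing_const := 2 * C / (1 - kappa).
Local Notation M := sewing_const.

Let gamma_gt0 : 0 < gamma. Proof. exact: lt_trans gamma1. Qed.

Let kappa_lt1 : kappa < 1.
Proof.
have := @gt0_ltr_powR R (gamma - 1) _ 2^-1 1; rewrite powR1; apply.
- by rewrite subr_gt0.
- by rewrite nnegrE invr_ge0.
- by rewrite nnegrE.
- by rewrite invf_lt1// ltr1n.
Qed.

Lemma sewing_const_ge0 : 0 <= M.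
Proof. by rewrite divr_ge0 ?mulr_ge0// subr_ge0 ltW. Qed.

Let M_fix : 2 * C + M * kappa = M.
Proof. by rewrite /M; field; rewrite gt_eqF// subr_gt0. Qed.

Let half_powR x : 0 <= x -> (x / 2) `^ gamma = x `^ gamma * kappa / 2.
Proof.
move=> x0; rewrite powRM ?invr_ge0// -(@mulr_powRB1 _ 2^-1) ?invr_ge0//.
by rewrite mulrA mulrAC.
Qed.

Let g_diag s : 0 <= s -> s <= T -> g s s = 0.
Proof.
move=> s0 sT; apply/eqP; rewrite -normr_le0.
have := almost_additive s0 (lexx s) (lexx s) sT.
by rewrite !subrr sub0r normrN powR0 ?mulr0// gt_eqF.
Qed.

(* Cut at the midpoint of [s,t]: the two pieces on either side of the interval
   containing it have at most half the length, and 2 * 2^-gamma < 1. *)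
Lemma chain_sum_near_germ s P : 0 <= s -> path <=%R s P -> last s P <= T ->
  `|chain_sum g s P - g s (last s P)| <= M * (last s P - s) `^ gamma.
Proof.
have [n] := ubnP (size P); elim: n s P => [//|n IH] s P Pn s0 sP PT.
have st : s <= last s P by rewrite path_le_last// mem_head.
have [->|P0] := eqVneq P [::].
  by rewrite /= sub0r normrN g_diag ?subrr ?powR0 ?gt_eqF ?mulr0 ?normr0// (le_trans st).
set t := last s P in st PT *.
pose mid := (s + t) / 2.
have hP : has (fun x => mid <= x) P.
  apply/hasP; exists t; last by rewrite /mid; lra.
  by rewrite /t; case: (P) P0 => //= y P' _; exact: mem_last.
have [x [P1 [P2 [xmid nP1 PE]]]] : exists x P1 P2,
    [/\ mid <= x, ~~ has (fun x => mid <= x) P1 & P = P1 ++ x :: P2].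
  case: (split_find hP) => x P1 P2 mx nP1; exists x, P1, P2; split => //.
  by rewrite cat_rcons.
have tE : t = last x P2 by rewrite /t PE last_cat.
move: sP; rewrite PE cat_path/= => /and3P[sP1 ux xP2].
set u := last s P1 in ux *.
have su : s <= u by rewrite path_le_last// mem_head.
have xt : x <= t by rewrite tE path_le_last// mem_head.
have umid : u <= mid.
  have : u \in s :: P1 by exact: mem_last.
  rewrite inE => /predU1P[->|uP1]; first by rewrite /mid; lra.
  by move/hasPn : nP1 => /(_ _ uP1); rewrite -ltNge => /ltW.
move: Pn; rewrite PE size_cat/= => Pn.
have P1n : (size P1 < n)%N by rewrite (leq_trans _ (ltnSE Pn))// addnS ltnS leq_addr.
have P2n : (size P2 < n)%N by rewrite (leq_trans _ (ltnSE Pn))// leq_addl.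
have x0 : 0 <= x by rewrite (le_trans s0)// (le_trans su).
have := IH s P1 P1n s0 sP1 (le_trans (le_trans ux xt) PT).
have := IH x P2 P2n x0 xP2; rewrite -tE -/u => /(_ PT) IH2 IH1.
have d1 := almost_additive s0 su (le_trans ux xt) PT.
have d2 := almost_additive (le_trans s0 su) ux xt PT.
have L0 : 0 <= t - s by rewrite subr_ge0.
have h1 : M * (u - s) `^ gamma <= M * ((t - s) `^ gamma * kappa / 2).
  rewrite ler_wpM2l ?sewing_const_ge0// -half_powR//.
  rewrite ge0_ler_powR ?nnegrE ?(ltW gamma_gt0)//;
    move: umid; rewrite /mid; lra.
have h2 : M * (t - x) `^ gamma <= M * ((t - s) `^ gamma * kappa / 2).
  rewrite ler_wpM2l ?sewing_const_ge0// -half_powR//.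
  rewrite ge0_ler_powR ?nnegrE ?(ltW gamma_gt0)//;
    move: xmid; rewrite /mid; lra.
have h3 : C * (t - u) `^ gamma <= C * (t - s) `^ gamma.
  rewrite ler_wpM2l// ge0_ler_powR ?nnegrE ?(ltW gamma_gt0)//; lra.
rewrite chain_sum_cat/= -/u.
(* The two inductive errors, plus the defects of cutting [s,t] at [u] and [u,t] at [x]. *)
have -> : chain_sum g s P1 + (g u x + chain_sum g x P2) - g s t =
  (chain_sum g s P1 - g s u) + (chain_sum g x P2 - g x t)
  - (g s t - g s u - g u t) - (g u t - g u x - g x t).
  rewrite !opprB !addrA.
  rewrite [RHS](ACl (1*9*3*7*(2*6)*(4*8)*(5*10)))/=.
  by rewrite !addNr subrr !addr0.
rewrite -M_fix (le_trans (ler_normB _ _))//.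
have := ler_normB (chain_sum g s P1 - g s u + (chain_sum g x P2 - g x t))
  (g s t - g s u - g u t).
have := ler_normD (chain_sum g s P1 - g s u) (chain_sum g x P2 - g x t).
move: IH1 IH2 d1 d2 h1 h2 h3.
move: ((t - s) `^ gamma) => L.
by lra.
Qed.

(** On each step [s,x] of [P] the error [M (x - s)^gamma] is at most [M d^(gamma - 1) (x - s)], and
    these lengths telescope. *)
Lemma chain_sum_refine s P Q d : 0 <= s ->
  path (fun x y => (x <= y) && (y - x <= d)) s P -> path <=%R s Q ->
  subseq P Q -> last s P = last s Q -> last s Q <= T ->
  `|chain_sum g s Q - chain_sum g s P| <=
    M * d `^ (gamma - 1) * (last s Q - s).
Proof.
elim: P s Q => [|x P IH] s Q s0 /=.
  move=> _ sQ _ lQ QT; rewrite -lQ subrr mulr0 subr0.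
  have := chain_sum_near_germ s0 sQ QT.
  by rewrite -lQ subrr powR0 ?gt_eqF// mulr0 g_diag ?subr0// lQ.
move=> /andP[/andP[sx xd] xP] sQ /subseq_consP[Q1 [Q2 [QE PQ2]]].
move: sQ; rewrite QE cat_path last_cat/= => /and3P[sQ1 Q1x xQ2] lP lT.
have x0 : 0 <= x by rewrite (le_trans s0).
have xT : x <= T by rewrite (le_trans _ lT)// path_le_last// mem_head.
have := IH x Q2 x0 xP xQ2 PQ2 lP lT.
have sQx : path <=%R s (rcons Q1 x) by rewrite rcons_path sQ1.
have := chain_sum_near_germ s0 sQx; rewrite last_rcons => /(_ xT).
rewrite -cat_rcons chain_sum_cat last_rcons => h1 h2.
have h3 : M * (x - s) `^ gamma <= M * d `^ (gamma - 1) * (x - s).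
  rewrite -mulrA ler_wpM2l ?sewing_const_ge0//.
  rewrite -(@mulr_powRB1 _ (x - s)) ?subr_ge0// mulrC ler_wpM2r ?subr_ge0//.
  by rewrite ge0_ler_powR ?nnegrE ?subr_ge0 ?(ltW gamma1) ?(le_trans _ xd)// subr_ge0.
have -> : chain_sum g s (rcons Q1 x) + chain_sum g x Q2 -
    (g s x + chain_sum g x P) = (chain_sum g s (rcons Q1 x) - g s x) +
    (chain_sum g x Q2 - chain_sum g x P) by rewrite opprD addrACA.
rewrite (le_trans (ler_normD _ _))//.
move: (M * d `^ (gamma - 1)) (M * (x - s) `^ gamma) h1 h2 h3 => c1 c2 h1 h2 h3.
by nra.
Qed.

Lemma mesh_ltP P d : itv_partition 0 T P -> mesh_lt P d ->
  path (fun x y => (x <= y) && (y - x <= d)) 0 P.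
Proof.
move=> [/(pathP 0) sP _] Pd; apply/(pathP 0) => i iP.
by rewrite (ltW (sP i iP))/= ltW// Pd.
Qed.

Lemma chain_sum_mesh P Q d : 0 <= T ->
  itv_partition 0 T P -> itv_partition 0 T Q -> mesh_lt P d -> mesh_lt Q d ->
  `|chain_sum g 0 P - chain_sum g 0 Q| <= 2 * (M * d `^ (gamma - 1) * T).
Proof.
move=> T0 pP pQ Pd Qd.
have mP := mesh_ltP pP Pd; have mQ := mesh_ltP pQ Qd.
have leP A : itv_partition 0 T A -> path <=%R 0 A.
  by case=> + _; apply: sub_path => x y /ltW.
have PT A x : itv_partition 0 T A -> x \in A -> x <= T.
  move=> pA xA; have [_ /eqP <-] := pA.
  by rewrite path_le_last ?leP// inE xA orbT.
have P0 A x : itv_partition 0 T A -> x \in A -> 0 <= x.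
  by move=> pA xA; rewrite (path_ge_head (leP _ pA))// inE xA orbT.
have srt A : itv_partition 0 T A -> sort <=%R A = A.
  by move=> /leP/path_sorted; by apply: sorted_sort; exact: le_trans.
(* The common refinement may repeat points. Repetitions are harmless because [g] vanishes on the
   diagonal, and they are the reason for the weak inequalities in the preceding bounds. *)
pose U := sort <=%R (P ++ Q).
have sU : path <=%R 0 U.
  rewrite path_min_sorted ?sort_le_sorted//.
  apply/allP => x; rewrite mem_sort mem_cat => /orP[]; exact: P0.
have lU : last 0 U = T.
  apply/eqP; rewrite eq_le; apply/andP; split.
    have := mem_last 0 U; rewrite inE => /predU1P[->//|].
    rewrite mem_sort mem_cat => /orP[]; exact: PT.
  rewrite path_le_last//; have [_ /eqP lP] := pP.
  have := mem_last 0 P; rewrite lP inE => /predU1P[->|TP]; first exact: mem_head.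
  by rewrite inE mem_sort mem_cat TP orbT.
have subU A : itv_partition 0 T A -> subseq A (P ++ Q) -> subseq A U.
  by move=> pA AU; rewrite -(srt A pA); apply: subseq_sort AU;
    [exact: le_total|exact: le_trans].
have bnd A : itv_partition 0 T A -> path (fun x y => (x <= y) && (y - x <= d)) 0 A ->
    subseq A (P ++ Q) -> `|chain_sum g 0 U - chain_sum g 0 A| <= M * d `^ (gamma - 1) * T.
  move=> pA mA AU; have := chain_sum_refine (lexx 0) mA sU (subU A pA AU).
  by have [_ /eqP ->] := pA; rewrite lU subr0; apply.
rewrite mulr2n mulrDl !mul1r.
rewrite (le_trans (ler_distD (chain_sum g 0 U) _ _))// lerD//.
  by rewrite distrC bnd ?prefix_subseq.
by rewrite bnd ?suffix_subseq.
Qed.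

End Bounds.

Lemma uniform_partition T d : 0 < T -> 0 < d ->
  exists2 P, itv_partition 0 T P & mesh_lt P d.
Proof.
move=> T0 d0.
pose n := Num.truncn (T / d).
have nd : T / n.+1%:R < d.
  rewrite ltr_pdivrMr// mulrC -ltr_pdivrMr//.
  by have /andP[] := truncn_itv (ltW (divr_gt0 T0 d0)).
pose P := mkseq (fun i => T * i.+1%:R / n.+1%:R) n.+1.
have nthP i : (i <= n.+1)%N -> nth 0 (0 :: P) i = T * i%:R / n.+1%:R.
  by case: i => [|i] iN /=; rewrite ?mulr0 ?mul0r// nth_mkseq.
exists P.
  split.
    apply/(pathP 0) => i; rewrite size_mkseq => iN.
    rewrite -[nth 0 P i]/(nth 0 (0 :: P) i.+1) !nthP ?(ltnW iN)//.
    by rewrite ltr_pM2r ?invr_gt0// ltr_pM2l// ltr_nat.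
  rewrite (last_nth 0) size_mkseq nthP//.
  by rewrite mulfK// pnatr_eq0.
move=> i; rewrite size_mkseq => iN; rewrite !nthP ?(ltnW iN)//.
by rewrite -mulrBl -mulrBr -natrB// subSnn mulr1.
Qed.

Lemma mesh_to0_filter T : 0 < T -> ProperFilter (@mesh_to0 R T).
Proof.
move=> T0; split.
  move=> [d d0 /= h]; have [P pP Pd] := uniform_partition T0 d0.
  exact: (h P).
split.
- by exists 1.
- move=> A B [d d0 Ad] [d' d'0 Bd]; exists (Num.min d d').
    by rewrite lt_min d0.
  move=> P pP Pd; split; [apply: Ad|apply: Bd] => // i iP;
    by rewrite (lt_le_trans (Pd i iP))// ge_min lexx ?orbT.
- by move=> A B AB [d d0 Ad]; exists d => // P pP Pd; apply/AB/Ad.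
Qed.

Lemma sewing (V : completeNormedModType R) (g : R -> R -> V) T C gamma :
  0 < T -> 0 <= C -> 1 < gamma ->
  (forall s u t, 0 <= s -> s <= u -> u <= t -> t <= T ->
    `|g s t - g s u - g u t| <= C * (t - s) `^ gamma) ->
  cvg (germ_sum g @ @mesh_to0 R T).
Proof.
move=> T0 C0 gamma1 gadd; have FT := mesh_to0_filter T0.
apply/cauchy_cvgP; apply: cauchy_exP => eps eps0.
(* [d] below is chosen so that [d^(gamma - 1) = eps / K]; the added 1 makes [K] positive and the
   final bound strict. *)
pose K := 2 * (sewing_const C gamma * T) + 1.
have K0 : 0 < K.
  by rewrite ltr_wpDl// mulr_ge0// mulr_ge0 ?sewing_const_ge0// ltW.
have g10 : 0 < gamma - 1 by rewrite subr_gt0.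
pose d := (eps / K) `^ (gamma - 1)^-1.
have d0 : 0 < d by rewrite powR_gt0// divr_gt0.
have dE : d `^ (gamma - 1) = eps / K.
  by rewrite -powRrM mulVf ?powRr1 ?gt_eqF// ltW// divr_gt0.
have [P pP Pd] := uniform_partition T0 d0.
exists (germ_sum g P); exists d => // Q pQ Qd.
rewrite /= -ball_normE /ball_/= !germ_sumE.
rewrite (le_lt_trans (chain_sum_mesh C0 gamma1 gadd (ltW T0) pP pQ Pd Qd))//.
rewrite dE [ltLHS](_ : _ = eps * ((K - 1) / K)); last by rewrite /K; ring.
by rewrite gtr_pMr// ltr_pdivrMr// mul1r gtrBl.
Qed.

End Sewing.

(** * Tensors in coordinates *)

Section TensorTheory.
Context {R : realType} {n : nat}.

Lemma tcoefE m (u : tens R n m) (w : m.-tuple 'I_n) : tcoef u w = u w.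
Proof. by rewrite /tcoef valK. Qed.

Lemma tcoef_slice m (u : tens R n m.+1) i (w : seq 'I_n) :
  tcoef (tslice u i) w = tcoef u (rcons w i).
Proof.
have [wm|wm] := boolP (size w == m).
  pose w' := Tuple wm; rewrite -[w in LHS]/(val w') tcoefE ffunE -tcoefE.
  by [].
by rewrite /tcoef !insubN// size_rcons eqSS.
Qed.

(** As [k <= m], the last letter of a word of length [m.+1] falls in the second factor. *)
Lemma tslice_mul k l m (x : tens R n k) (y : tens R n l.+1) i : (k <= m)%N ->
  tslice (tmul x y : tens R n m.+1) i = tmul x (tslice y i).
Proof.
move=> km; apply/ffunP => w; rewrite !ffunE/= tcoef_slice drop_rcons ?size_tuple//.
by congr (tcoef x _ * _); rewrite -cats1 takel_cat// size_tuple.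
Qed.

Lemma tmul1 m (x : tens R n m) : tmul x tone = x.
Proof.
apply/ffunP => w; rewrite !ffunE take_oversize ?size_tuple// tcoefE.
rewrite drop_oversize ?size_tuple// (_ : [::] = val [tuple]) //.
by rewrite tcoefE ffunE mulr1.
Qed.

(** The coordinates of a slice are among those of [u], through the injection [w -> rcons w i]. *)
Lemma tnorm_slice m (u : tens R n m.+1) i : tnorm (tslice u i) <= tnorm u.
Proof.
rewrite /tnorm ler_sqrt; last by rewrite sumr_ge0// => w _; exact: sqr_ge0.
pose h (w : m.-tuple 'I_n) := [tuple of rcons w i].
have hinj : injective h.
  move=> v w /(congr1 val)/= /rcons_inj[vw].
  exact: val_inj.
rewrite [leRHS](bigID (mem (h @: finset.setTfor (m.-tuple 'I_n))))/=.
rewrite big_imset/=; last by move=> ? ? _ _; exact: hinj.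
rewrite [X in _ <= X + _](_ : _ = \sum_w tslice u i w ^+ 2).
  by rewrite lerDl sumr_ge0// => w _; exact: sqr_ge0.
by apply: eq_big => [w|w _]; rewrite ?inE ?ffunE.
Qed.

End TensorTheory.

(** Reindexes a triangle from total degree [m = j + k] to pairs [(j, k)]; raising [N] by one adds
    the antidiagonal [j + k = N]. *)
Lemma sum_triangle (V : zmodType) (G : nat -> nat -> V) N :
  \sum_(m < N) \sum_(k < m.+1) G (m - k)%N k = \sum_(j < N) \sum_(k < N - j) G j k.
Proof.
elim: N => [|N IH]; first by rewrite !big_ord0.
rewrite big_ord_recr/= IH [RHS]big_ord_recr/= subSnn big_ord1.
under [in RHS]eq_bigr => j _ do rewrite subSn ?(ltnW (ltn_ord j))// big_ord_recr/=.
rewrite big_split/= -addrA; congr (_ + _).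
transitivity (\sum_(j < N.+1) G j (N - j)%N); last by rewrite big_ord_recr/= subnn.
rewrite (reindex_inj rev_ord_inj)/=; apply: eq_bigr => i _.
by rewrite subSS subKn// -ltnS.
Qed.

(** * Rough integrals as limits of compensated Riemann sums *)

Section RoughIntegral.
Context {R : realType} {n : nat} {H : vectType R} (dotH : {dot H for idfun}).
Context {V : hilbertSpace R} (e : n.-tuple H) (T alpha : R).
Context (xi : forall m, R -> R -> tens R n m).
Context (A : forall m, R -> {bilinear tens R n m -> H -> V}).
Hypothesis T0 : 0 < T.
Hypothesis alpha0 : 0 < alpha.
Hypothesis xi_rough : rough_path T alpha xi.
Hypothesis A_controlled : controlled_path dotH T alpha xi A.
Local Notation N := (rough_level alpha).

Lemma tapply_sum m s k (u : 'I_k -> tens R n m.+1) :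
  tapply e (A m s) (\sum_i u i) = \sum_i tapply e (A m s) (u i).
Proof.
rewrite /tapply exchange_big/=; apply: eq_bigr => i _.
rewrite -linear_sumlz; congr (A m s _ _); apply/ffunP => w.
by rewrite ffunE !sum_ffunE; apply: eq_bigr => j _; rewrite ffunE.
Qed.

Definition rough_germ s t := \sum_(m < N) tapply e (A m s) (xi m.+1 s t).

(** In Chen's expansion of [xi m.+1 s t] the top term [k = m.+1] reproduces the germ on [s,u].
    Grouping the others by the degree [j.+1] of the factor on [u,t] leaves exactly the controlled
    remainders of the [A j] at [u]. *)
Lemma rough_germ_defect s u t : 0 <= s -> s <= u -> u <= t -> t <= T ->
  rough_germ s t - rough_germ s u - rough_germ u t =
  \sum_(j < N) (\sum_(k < N - j) tapply e (A (j + k)%N s)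
    (tmul (xi k s u) (xi j.+1 u t)) - tapply e (A j u) (xi j.+1 u t)).
Proof.
move=> s0 su ut tT.
rewrite sumrB; congr (_ - _).
pose G j k := tapply e (A (j + k)%N s) (tmul (xi k s u) (xi j.+1 u t)).
rewrite -(sum_triangle G) /rough_germ -sumrB; apply: eq_bigr => m _.
rewrite (rough_chen xi_rough _ s0 su ut tT)// tapply_sum big_ord_recr/= subnn.
rewrite (rough_level0 xi_rough) ?(le_trans s0 su)// tmul1 addrK.
apply: eq_bigr => k _; rewrite /G.
have : (k <= m)%N by rewrite -ltnS.
move: (nat_of_ord k) => {}k; move: (nat_of_ord m) => {}m km.
(* Writing [m] as [j + k] makes the dependent degrees on both sides agree. *)
rewrite subSn//; move: (subnK km); move: (m - k)%N => j jk.
by rewrite -jk.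
Qed.

(** The remainder of [A j] has order [(N - j) alpha] and [xi j.+1] has order [(j + 1) alpha]: the
    orders add up to [(N + 1) alpha] for every [j]. *)
Lemma rough_germ_almost_additive : exists2 C, 0 <= C &
  forall s u t, 0 <= s -> s <= u -> u <= t -> t <= T ->
  `|rough_germ s t - rough_germ s u - rough_germ u t| <=
    C * (t - s) `^ (N.+1%:R * alpha).
Proof.
have [C AC] := A_controlled; have [C' xiC] := rough_holder xi_rough.
pose E := \sum_(i < n) Num.sqrt (dotH (tnth e i) (tnth e i)).
have E0 : 0 <= E by rewrite sumr_ge0// => i _; exact: sqrtr_ge0.
(* [C] and [C'] come without a sign, hence the absolute values; [E] collects the norms of the basis
   vectors on which the slices are evaluated. *)
exists (\sum_(j < N) (`|C| * `|C'| * E)).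
  by rewrite sumr_ge0// => j _; rewrite !mulr_ge0.
move=> s u t s0 su ut tT; rewrite rough_germ_defect//.
rewrite (le_trans (ler_norm_sum _ _ _))// mulr_suml ler_sum// => j _.
have sL : 0 <= t - s by rewrite subr_ge0 (le_trans su).
set w := xi j.+1 u t.
have wL : tnorm w <= `|C'| * (t - s) `^ (j.+1%:R * alpha).
  have su0 : 0 <= u by rewrite (le_trans s0).
  rewrite (le_trans (xiC _ _ _ _ su0 ut tT))//.
  apply: (@le_trans _ _ (`|C'| * (t - u) `^ (j.+1%:R * alpha))).
    by rewrite ler_wpM2r ?powR_ge0 ?ler_norm.
  rewrite ler_wpM2l// ge0_ler_powR ?nnegrE ?mulr_ge0 ?(ltW alpha0)//; lra.
rewrite /tapply.
rewrite exchange_big -sumrB mulr_sumr mulr_suml /= -/w.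
rewrite (le_trans (ler_norm_sum _ _ _))// ler_sum// => i _.
have [Aj _] := AC j s u (ltn_ord j) s0 su (le_trans ut tT).
rewrite distrC.
under eq_bigr do rewrite (tslice_mul _ _ _ (leq_addl _ _)).
rewrite (le_trans (Aj _ _))//.
have -> : N.+1%:R * alpha = (N - j)%:R * alpha + j.+1%:R * alpha.
  by rewrite -mulrDl -natrD addnS subnK// ltnW.
rewrite powRD; last first.
  rewrite -mulrDl -natrD addnS mulf_eq0 pnatr_eq0/=.
  by rewrite (gt_eqF alpha0).
rewrite -!mulrA [leRHS](_ : _ = `|C| * ((t - s) `^ ((N - j)%:R * alpha) *
  (`|C'| * (t - s) `^ (j.+1%:R * alpha) *
  Num.sqrt (dotH (tnth e i) (tnth e i))))); last by ring.
apply: (@le_trans _ _ (`|C| * ((u - s) `^ ((N - j)%:R * alpha) *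
    (tnorm (tslice w i) * Num.sqrt (dotH (tnth e i) (tnth e i)))))).
  by rewrite ler_wpM2r ?ler_norm ?mulr_ge0 ?powR_ge0 ?sqrtr_ge0.
rewrite ler_wpM2l// ler_pM ?powR_ge0 ?mulr_ge0 ?sqrtr_ge0//.
  rewrite ge0_ler_powR ?nnegrE ?mulr_ge0 ?(ltW alpha0)//; lra.
by rewrite ler_wpM2r ?sqrtr_ge0// (le_trans (tnorm_slice _ _)).
Qed.

Lemma rough_exponent_gt1 : 1 < N.+1%:R * alpha.
Proof.
rewrite -ltr_pdivrMr//.
by have /andP[] := truncn_itv (ltW (divr_gt0 ltr01 alpha0)).
Qed.

Lemma rough_int_cvg : germ_sum rough_germ @ @mesh_to0 R T --> rough_int e T alpha xi A.
Proof.
have [C C0 gadd] := rough_germ_almost_additive.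
exact: sewing T0 C0 rough_exponent_gt1 gadd.
Qed.

Lemma rough_pairE F : rough_pair e T alpha xi A F = hdot F (rough_int e T alpha xi A).
Proof.
have FT := mesh_to0_filter T0.
rewrite /rough_pair /germ_lim; apply: (cvg_lim (@norm_hausdorff _ R^o)).
rewrite (_ : germ_sum _ = fun P => hdot F (germ_sum rough_germ P)).
  exact: hdot_cvgr rough_int_cvg.
apply/funext => P; rewrite /germ_sum hdot_sumr; apply: eq_bigr => i _.
by rewrite hdot_sumr.
Qed.

End RoughIntegral.

(** * Subgradients of convex functions of a real variable *)

Section ConvexReal.
Context {R : realType}.
Implicit Types (f : R -> R) (w h g : R).

Definition cvx f := forall t x y, 0 <= t <= 1 ->
  f (t * x + (1 - t) * y) <= t * f x + (1 - t) * f y.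

Lemma convex_function_cvx f :
  convex_function [set: R^o] (f : R^o -> R^o) -> cvx f.
Proof.
move=> cf t x y t01.
have t01' : t \in `[0, 1] by rewrite in_itv.
have := cf (Itv01 (andP t01).1 (andP t01).2) x y (mem_setT _) (mem_setT _).
by [].
Qed.

(** Steps [1/(n+1)] rather than a continuous parameter: the limit is then that of a sequence, and
    measurability passes to it when [f] and [w] depend on a point. *)
Definition dquot f w h n := n.+1%:R * (f (w + h / n.+1%:R) - f w).

Section Quotients.
Variables (f : R -> R) (w h : R).
Hypothesis cf : cvx f.
Let phi s := f (w + s * h).

Let phi_cvx t x y : 0 <= t <= 1 ->
  phi (t * x + (1 - t) * y) <= t * phi x + (1 - t) * phi y.
Proof.
move=> t01; rewrite /phi [X in f X](_ : _ =
  t * (w + x * h) + (1 - t) * (w + y * h)) ?cf//.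
by ring.
Qed.

Lemma slope_mono s t : 0 < s -> s <= t ->
  (phi s - phi 0) / s <= (phi t - phi 0) / t.
Proof.
move=> s0 st; have t0 : 0 < t by exact: lt_le_trans st.
have := @phi_cvx (s / t) t 0.
rewrite divr_ge0 ?(ltW s0) ?(ltW t0)//= ler_pdivrMr// mul1r => /(_ st).
rewrite mulr0 addr0 divfK ?gt_eqF// => hst.
rewrite ler_pdivrMr// mulrAC -mulrA.
have -> : (phi t - phi 0) * (s / t) = s / t * phi t + (1 - s / t) * phi 0 - phi 0.
  by ring.
by rewrite lerB.
Qed.

(** 0 is the convex combination of [t] and [- s] with weights [s / (s + t)] and [t / (s + t)]. *)
Lemma slope_left_right s t : 0 < s -> 0 < t ->
  (phi 0 - phi (- s)) / s <= (phi t - phi 0) / t.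
Proof.
move=> s0 t0; have st0 : 0 < s + t by rewrite addr_gt0.
have := @phi_cvx (s / (s + t)) t (- s).
rewrite divr_ge0 ?(ltW s0) ?(ltW st0)//= ler_pdivrMr// mul1r lerDl (ltW t0) => /(_ isT).
have -> : s / (s + t) * t + (1 - s / (s + t)) * (- s) = 0.
  by field; rewrite gt_eqF.
have -> : 1 - s / (s + t) = t / (s + t) by field; rewrite gt_eqF.
rewrite mulrAC (mulrAC t) -mulrDl ler_pdivlMr// => h1.
rewrite ler_pdivrMr// mulrAC ler_pdivlMr//.
by nra.
Qed.

Let dquotE n : dquot f w h n = (phi n.+1%:R^-1 - phi 0) / n.+1%:R^-1.
Proof. by rewrite /dquot /phi mul0r addr0 invrK mulrC [h / _]mulrC. Qed.

(** This bound and the next do not depend on [n]; they are used later to dominate the quotients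
    under the integral. *)
Lemma dquot_le n : dquot f w h n <= f (w + h) - f w.
Proof.
rewrite dquotE (le_trans (slope_mono _ (_ : _ <= 1)))// ?invf_le1 ?ler1n//.
by rewrite divr1 /phi mul1r mul0r addr0.
Qed.

Lemma dquot_ge n : f w - f (w - h) <= dquot f w h n.
Proof.
have := @slope_left_right 1 n.+1%:R^-1 ltr01.
by rewrite dquotE invr_gt0 ltr0n divr1 /phi mulN1r mul0r addr0; exact.
Qed.

(** The limit lies below all slopes on the side of [h] and above all slopes on the other side, so
    after division by [h] it is the slope of a supporting line. *)
Lemma dquot_cvg : h != 0 ->
  exists2 g, subdiff f w g & dquot f w h n / h @[n --> \oo] --> g.
Proof.
move=> h0.
have nd : nonincreasing_seq (dquot f w h).
  move=> n m nm; rewrite !dquotE slope_mono// lef_pV2 ?posrE ?ltr0n// ler_nat.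
  exact: nm.
have cv : cvgn (dquot f w h).
  apply: nonincreasing_is_cvgn => //; exists (f w - f (w - h)).
  by move=> _ [n _ <-]; exact: dquot_ge.
set G := limn (dquot f w h) in cv *.
exists (G / h); last by apply: cvgMl.
move=> w'; pose s := (w' - w) / h.
have -> : w' = w + s * h by rewrite /s divfK// addrC subrK.
have -> : G / h * (w + s * h - w) = s * G by field.
rewrite -/(phi s) (_ : f w = phi 0); last by rewrite /phi mul0r addr0.
have [s0|s0|->] := ltgtP s 0; last by rewrite mul0r addr0.
- have : (phi s - phi 0) / s <= G.
    apply: limr_ge => //; apply: nearW => n; rewrite dquotE.
    have := @slope_left_right (- s) n.+1%:R^-1.
    by rewrite oppr_gt0 opprK invr_gt0 ltr0n invrN mulrN -mulNr opprB; exact.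
  by rewrite ler_ndivrMr// lerBrDl mulrC.
- have : G <= (phi s - phi 0) / s.
    apply: limr_le => //; near=> n; rewrite dquotE slope_mono//.
    near: n; have /cvgrPdist_le /(_ _ s0) := @cvg_harmonic R.
    by apply: filterS => n; rewrite /harmonic/= sub0r normrN ger0_norm.
  by rewrite ler_pdivlMr// lerBrDl mulrC.
Unshelve. all: by end_near. Qed.

End Quotients.

(* Test the subgradient inequality at distance [(A + |w|^p + 1)^(1/p)] from [w];
   for [p = 1] the bound is a constant. *)
Lemma subdiff_growth f w g (A b p : R) : 1 <= p -> 0 <= A -> 0 <= b ->
  (forall x, 0 <= f x) -> (forall x, f x <= A + b * `|x| `^ p) ->
  subdiff f w g ->
  `|g| <= (1 + b * 2 `^ p) * (A + `|w| `^ p + 1) `^ (1 - p^-1).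
Proof.
move=> p1 A0 b0 f0 fle dfg.
have p0 : 0 < p by exact: lt_le_trans p1.
set s := A + `|w| `^ p + 1.
have s1 : 1 <= s by rewrite lerDr addr_ge0 ?powR_ge0.
have s0 : 0 < s by exact: lt_le_trans s1.
pose r := s `^ p^-1.
have r0 : 0 < r by rewrite powR_gt0.
have rp : r `^ p = s by rewrite /r -powRrM mulVf ?powRr1 ?gt_eqF ?ltW.
have wr : `|w| <= r.
  have -> : `|w| = (`|w| `^ p) `^ p^-1.
    by rewrite -powRrM divff ?powRr1 ?gt_eqF.
  rewrite ge0_ler_powR ?nnegrE ?powR_ge0 ?invr_ge0 ?(ltW p0) ?(ltW s0)//.
  by rewrite /s ltW// ltr_pwDr// lerDr.
(* Moving in the direction of the sign of [g] turns the linear term into [|g| * r], while the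
   argument of [f] stays within [2 * r]. *)
have := dfg (w + r * Num.sg g).
rewrite addrAC subrr add0r mulrCA (mulrC g) -normrEsg => h1.
have : `|g| * r <= (1 + b * 2 `^ p) * s.
  rewrite mulrC (le_trans (_ : _ <= f (w + r * Num.sg g)))//.
    by rewrite (le_trans _ h1)// lerDr.
  rewrite (le_trans (fle _))// mulrDl mul1r lerD//.
    by rewrite /s -addrA lerDl addr_ge0 ?powR_ge0.
  rewrite -mulrA ler_wpM2l// -rp -powRM ?(ltW r0)//.
  rewrite ge0_ler_powR ?nnegrE ?mulr_ge0 ?(ltW r0) ?(ltW p0)//.
  rewrite (le_trans (ler_normD _ _))// mulr2n mulrDl mul1r lerD//.
  rewrite normrM (gtr0_norm r0) ler_piMr ?(ltW r0)// normr_sg.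
  by case: (_ != 0).
rewrite -ler_pdivlMr// -mulrA (_ : s / r = s `^ (1 - p^-1))//.
by rewrite powRB ?powRr1 ?(ltW s0)// (gt_eqF s0) implybT.
Qed.

End ConvexReal.

(** * Regularised risks of linear functionals of a feature map *)

Section RealIntegration.
Context d (Om : measurableType d) {R : realType}.
Context (mu : {measure set Om -> \bar R}) (D : set Om).
Hypothesis mD : measurable D.
Implicit Types f g : Om -> R.

Definition rintegrable f := mu.-integrable D (EFin \o f).

Lemma rintegrable_meas f : rintegrable f -> measurable_fun D f.
Proof. by move=> /measurable_int/measurable_EFinP. Qed.

Lemma rintegrable_le f g : measurable_fun D f ->
  (forall z, D z -> `|f z| <= g z) -> rintegrable g -> rintegrable f.
Proof.
move=> mf fg; apply: le_integrable => //; first exact/measurable_EFinP.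
by move=> z Dz; rewrite /= lee_fin (le_trans (fg z Dz))// ler_norm.
Qed.

Lemma rintegrable_ae_le f g : measurable_fun D f ->
  {ae mu, forall z, D z -> `|f z| <= g z} -> rintegrable g -> rintegrable f.
Proof.
move=> mf fg /integrableP[mg goo]; apply/integrableP; split.
  exact/measurable_EFinP.
apply: le_lt_trans goo; apply: ae_ge0_le_integral => //.
- by apply: measurableT_comp => //; exact/measurable_EFinP.
- exact: measurableT_comp.
- by apply: filterS fg => z h Dz; rewrite /= lee_fin (le_trans (h Dz))// ler_norm.
Qed.

Lemma rintegrable_cst c : (mu D < +oo)%E -> rintegrable (fun=> c).
Proof.
move=> muD; apply/integrableP; split; first exact/measurable_EFinP.
under eq_integral do rewrite /=.
by rewrite integral_cst// lte_mul_pinfty.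
Qed.

Lemma rintegrableD f g : rintegrable f -> rintegrable g ->
  rintegrable (fun z => f z + g z).
Proof. by move=> If Ig; have := integrableD mD If Ig. Qed.

Lemma rintegrableB f g : rintegrable f -> rintegrable g ->
  rintegrable (fun z => f z - g z).
Proof. by move=> If Ig; have := integrableB mD If Ig. Qed.

Lemma rintegrableZ c f : rintegrable f -> rintegrable (fun z => c * f z).
Proof. by move=> If; have := integrableZl mD c If. Qed.

Lemma rintegrable_norm f : rintegrable f -> rintegrable (fun z => `|f z|).
Proof. by move=> If; have := integrable_norm If. Qed.

Lemma rintegralZ c f : rintegrable f ->
  \int[mu]_(z in D) (c * f z) = c * \int[mu]_(z in D) f z.
Proof. exact: RintegralZl. Qed.

Lemma rintegralD f g : rintegrable f -> rintegrable g ->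
  \int[mu]_(z in D) (f z + g z) =
  \int[mu]_(z in D) f z + \int[mu]_(z in D) g z.
Proof. exact: RintegralD. Qed.

Lemma rintegralB f g : rintegrable f -> rintegrable g ->
  \int[mu]_(z in D) (f z - g z) =
  \int[mu]_(z in D) f z - \int[mu]_(z in D) g z.
Proof. exact: RintegralB. Qed.

Lemma rintegral_le f g : rintegrable f -> rintegrable g ->
  (forall z, D z -> f z <= g z) ->
  \int[mu]_(z in D) f z <= \int[mu]_(z in D) g z.
Proof. exact: le_Rintegral. Qed.

Lemma rintegral_norm f : rintegrable f ->
  `|\int[mu]_(z in D) f z| <= \int[mu]_(z in D) `|f z|.
Proof. exact: le_normr_Rintegral. Qed.

Lemma rintegral_dominated (F : nat -> Om -> R) f g :
  (forall n, measurable_fun D (F n)) ->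
  (forall z, D z -> F n z @[n --> \oo] --> f z) ->
  (forall n z, D z -> `|F n z| <= g z) -> rintegrable g ->
  rintegrable f /\
  \int[mu]_(z in D) F n z @[n --> \oo] --> \int[mu]_(z in D) f z.
Proof.
move=> mF Ff Fg Ig.
have mf : measurable_fun D f by apply: measurable_fun_cvg Ff.
have [||||If _ cF] := @dominated_convergence _ _ _ mu D mD (fun n => EFin \o F n)
  (EFin \o f) (EFin \o g) _ _ _ Ig _.
- by move=> n; exact/measurable_EFinP.
- exact/measurable_EFinP.
- apply: aeW => z Dz; apply: cvg_EFin; [exact: nearW|exact: Ff].
- by apply: aeW => z n Dz /=; rewrite lee_fin Fg.
split=> //; apply: fine_cvg.
by rewrite fineK//; exact: integrable_fin_num.
Qed.

Lemma eq_Rintegral_ae f g : measurable_fun D f -> measurable_fun D g ->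
  {ae mu, forall z, D z -> f z = g z} ->
  \int[mu]_(z in D) f z = \int[mu]_(z in D) g z.
Proof.
move=> mf mg fg; congr fine; apply: ae_eq_integral => //.
- exact/measurable_EFinP.
- exact/measurable_EFinP.
- by apply: filterS fg => z h Dz; rewrite /= h.
Qed.

Lemma rintegral_ae_ge0 f : rintegrable f -> {ae mu, forall z, D z -> 0 <= f z} ->
  0 <= \int[mu]_(z in D) f z.
Proof.
move=> If f0; rewrite (@eq_Rintegral_ae _ (fun z => `|f z|)).
- exact: Rintegral_ge0.
- exact: rintegrable_meas.
- by apply: measurableT_comp => //; exact: rintegrable_meas.
- by apply: filterS f0 => z h Dz; rewrite ger0_norm ?h.
Qed.

Lemma summable_increments_cvg (b : nat -> R) :
  (\sum_(n <oo) `|b n.+1 - b n|%:E < +oo)%E -> cvgn b.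
Proof.
set S := (\sum_(n <oo) _)%E => Sfin.
have S0 : (0 <= S)%E by apply: nneseries_ge0 => n _ _; rewrite lee_fin.
have -> : b = (fun n => series (fun n => b n.+1 - b n) n + b 0%N).
  by apply/funext => n; rewrite /series/= telescope_sumr// subrK.
apply: is_cvgD; last exact: is_cvg_cst.
apply: normed_cvg; apply: nondecreasing_is_cvgn.
  by apply: nondecreasing_series => n _ _; exact: normr_ge0.
exists (fine S) => _ [n _ <-]; rewrite -lee_fin fineK ?ge0_fin_numE//.
rewrite /series/= -sumEFin.
by apply: nneseries_lim_ge => k _; rewrite lee_fin.
Qed.

(** The sum of the increments has integral at most [2 * c], so it is finite almost everywhere. [E]
    is its finiteness set, boolean so that functions can be pasted along it. *)
Lemma fast_cauchy_cvg (b : nat -> Om -> R) (c : R) :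
  (forall n, measurable_fun D (b n)) ->
  (forall n, rintegrable (fun z => `|b n.+1 z - b n z|)) ->
  (forall n, \int[mu]_(z in D) `|b n.+1 z - b n z| <= c * 2^-1 ^+ n) ->
  exists E : Om -> bool,
    [/\ measurable_fun D E, {ae mu, forall z, D z -> E z} &
        forall z, E z -> cvgn (b ^~ z)].
Proof.
move=> mb Ib bc.
pose S z := (\sum_(n <oo) `|b n.+1 z - b n z|%:E)%E.
have mbn n : measurable_fun D (fun z => `|b n.+1 z - b n z|%:E).
  by apply/measurable_EFinP; apply: measurableT_comp => //; exact: measurable_funB.
have S0 z : (0 <= S z)%E by apply: nneseries_ge0 => n _ _; rewrite lee_fin.
have mS : measurable_fun D S by exact: ge0_emeasurable_sum.
have c0 : 0 <= c.
  by have := bc 0%N; rewrite expr0 mulr1; apply: le_trans; exact: Rintegral_ge0.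
have IS : (\int[mu]_(z in D) S z < +oo)%E.
  rewrite integral_nneseries//.
  apply: (@le_lt_trans _ _ (2 * c)%:E); last exact: ltry.
  apply: lime_le.
    by apply: is_cvg_nneseries => n _ _; apply: integral_ge0 => z _; rewrite lee_fin.
  apply: nearW => n.
  apply: (@le_trans _ _ (\sum_(0 <= k < n) (c * 2^-1 ^+ k)%:E)%E).
    apply: lee_sum => k _.
    rewrite -[leLHS]fineK; last exact: (integrable_fin_num mD (Ib k)).
    by rewrite lee_fin bc.
  rewrite sumEFin lee_fin.
  have -> : \sum_(0 <= k < n) c * 2^-1 ^+ k = 2 * c - 2 * c * 2^-1 ^+ n.
    elim: n => [|n IH]; first by rewrite big_geq// expr0 mulr1 subrr.
    by rewrite big_nat_recr//= IH exprS; field.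
  by rewrite gerBl !mulr_ge0// exprn_ge0// invr_ge0.
exists (fun z => S z \is a fin_num); split.
- by apply: (measurable_fun_bool true); exact: emeasurable_fin_num.
- apply: integrable_ae => //; apply/integrableP; split => //.
  by under eq_integral do rewrite gee0_abs//.
- move=> z; rewrite ge0_fin_numE// => /summable_increments_cvg.
  exact.
Qed.

End RealIntegration.

Section RegularizedRisk.
Context d (Om : measurableType d) {R : realType}.
Context (mu : {measure set Om -> \bar R}) (D : set Om).
Context {V : hilbertSpace R} (phi : Om -> V).
Context (f : Om -> R -> R) (A : Om -> R) (b p : R).
Hypothesis mD : measurable D.
Hypothesis muD : (mu D < +oo)%E.
Hypothesis p1 : 1 <= p.
Hypothesis b0 : 0 <= b.
Hypothesis meas_ev : forall F, measurable_fun D (fun z => hdot F (phi z)).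
Hypothesis meas_phi : measurable_fun D (fun z => `|phi z|).
Hypothesis int_phi : rintegrable mu D (fun z => `|phi z| `^ p).
Hypothesis f_ge0 : forall z x, D z -> 0 <= f z x.
Hypothesis f_cvx : forall z, D z -> cvx (f z).
Hypothesis f_meas : forall w : Om -> R, measurable_fun D w ->
  measurable_fun D (fun z => f z (w z)).
Hypothesis A_ge0 : forall z, D z -> 0 <= A z.
Hypothesis int_A : rintegrable mu D A.
Hypothesis f_growth : forall z x, D z -> f z x <= A z + b * `|x| `^ p.
Implicit Types (F G u v : V) (a w : Om -> R).

Local Notation ev F z := (hdot F (phi z)).

Let p0 : 0 < p. Proof. exact: lt_le_trans p1. Qed.

Let meas_powR (g : Om -> R) q : measurable_fun D g ->
  measurable_fun D (fun z => g z `^ q).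
Proof. exact: (measurableT_comp (measurable_powR q)). Qed.

Let meas_norm (g : Om -> R) : measurable_fun D g -> measurable_fun D (fun z => `|g z|).
Proof. exact: measurableT_comp. Qed.

Let int_cst (c : R) : rintegrable mu D (fun=> c).
Proof. exact: rintegrable_cst. Qed.

Lemma int_ev_powR F : rintegrable mu D (fun z => `|ev F z| `^ p).
Proof.
apply: (@rintegrable_le _ _ _ _ _ mD _ (fun z => `|F| `^ p * `|phi z| `^ p)) => //.
- by apply: meas_powR; exact: meas_norm.
- move=> z Dz /=; rewrite ger0_norm ?powR_ge0// -powRM//.
  by rewrite ge0_ler_powR ?nnegrE ?mulr_ge0 ?(ltW p0)// hdot_le.
- exact: rintegrableZ.
Qed.

Lemma int_risk F : rintegrable mu D (fun z => f z (ev F z)).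
Proof.
apply: (@rintegrable_le _ _ _ _ _ mD _ (fun z => A z + b * `|ev F z| `^ p)) => //.
- exact: f_meas.
- by move=> z Dz /=; rewrite ger0_norm ?f_ge0// f_growth.
- by apply: rintegrableD => //; apply: rintegrableZ => //; exact: int_ev_powR.
Qed.

Lemma int_ev_mul G a : measurable_fun D a ->
  rintegrable mu D (fun z => `|phi z| * `|a z|) ->
  rintegrable mu D (fun z => ev G z * a z).
Proof.
move=> ma Ia.
apply: (@rintegrable_le _ _ _ _ _ mD _ (fun z => `|G| * (`|phi z| * `|a z|))) => //.
- exact: measurable_funM.
- by move=> z Dz /=; rewrite normrM mulrA ler_wpM2r// hdot_le.
- exact: rintegrableZ.
Qed.

(** [u] is the Pettis integral of [a * phi]. *)
Definition weak_int a u := forall G, hdot G u = \int[mu]_(z in D) (ev G z * a z).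

Lemma weak_int_exists a : measurable_fun D a ->
  rintegrable mu D (fun z => `|phi z| * `|a z|) -> exists u, weak_int a u.
Proof.
move=> ma Ia; have Iev G := int_ev_mul G ma Ia.
have [|//||||u _ uP] := @riesz R V setT (fun G => \int[mu]_(z in D) (ev G z * a z))
  (\int[mu]_(z in D) (`|phi z| * `|a z|)).
- exact: closedT.
- by [].
- move=> c F G /=; rewrite -rintegralZ// -rintegralD//.
    by apply: eq_Rintegral => z _; rewrite hdotDl hdotZl mulrDl mulrA.
  exact: rintegrableZ.
- move=> F /=; rewrite (le_trans (rintegral_norm mD _))//.
  rewrite mulrC -rintegralZ//; apply: rintegral_le => //.
  + exact: rintegrable_norm.
  + exact: rintegrableZ.
  + by move=> z Dz /=; rewrite normrM mulrA ler_wpM2r// hdot_le.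
by exists u => G; exact: uP.
Qed.

Section Subgradients.
Variable w : Om -> R.
Hypothesis meas_w : measurable_fun D w.
Hypothesis int_w : rintegrable mu D (fun z => `|w z| `^ p).

(** The exponent is [1/q]. The added 1 keeps the value at least 1 on [D], so that one may divide by
    it. *)
Definition envelope z := (A z + `|w z| `^ p + 1) `^ (1 - p^-1).
Local Notation kappa := envelope.
Let c := 1 + b * 2 `^ p.

Let c0 : 0 < c.
Proof. by rewrite ltr_pwDl// mulr_ge0// powR_ge0. Qed.

Let q0 : 0 <= 1 - p^-1.
Proof. by rewrite subr_ge0 invf_le1. Qed.

Let base1 z : D z -> 1 <= A z + `|w z| `^ p + 1.
Proof. by move=> Dz; rewrite lerDr addr_ge0 ?A_ge0 ?powR_ge0. Qed.

Lemma envelope_ge1 z : D z -> 1 <= kappa z.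
Proof.
move=> Dz; have -> : 1 = 1 `^ (1 - p^-1) :> R by rewrite powR1.
by rewrite ge0_ler_powR ?nnegrE ?base1// (le_trans ler01 (base1 Dz)).
Qed.

Let kappa0 z : D z -> 0 < kappa z.
Proof. by move=> /envelope_ge1; exact: lt_le_trans. Qed.

Let meas_base : measurable_fun D (fun z => A z + `|w z| `^ p + 1).
Proof.
apply: measurable_funD => //; apply: measurable_funD; first exact: rintegrable_meas int_A.
by apply: meas_powR; exact: meas_norm.
Qed.

Let meas_kappa : measurable_fun D kappa.
Proof. exact: meas_powR. Qed.

Let int_base : rintegrable mu D (fun z => A z + `|w z| `^ p + 1).
Proof. by apply: rintegrableD => //; exact: rintegrableD. Qed.

(** With [s] the base of the envelope, compare [|phi|] with [s^(1/p)]: below it the product is at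
    most [s], above it at most [|phi|^p]. The case [p = 1] needs no separate treatment. *)
Lemma int_phi_envelope : rintegrable mu D (fun z => `|phi z| * kappa z).
Proof.
apply: (@rintegrable_le _ _ _ _ _ mD _
  (fun z => `|phi z| `^ p + (A z + `|w z| `^ p + 1))) => //.
- exact: measurable_funM.
- move=> z Dz /=; rewrite /kappa; move: (base1 Dz); set s := A z + _ + 1 => s1.
  have s0 : 0 < s by exact: lt_le_trans s1.
  rewrite ger0_norm ?mulr_ge0 ?powR_ge0//.
  have pp : 1 - p^-1 = (p - 1) / p by field; rewrite gt_eqF.
  have [h|h] := lerP `|phi z| (s `^ p^-1).
    apply: (@le_trans _ _ s); last by rewrite lerDr powR_ge0.
    rewrite (le_trans (ler_wpM2r _ h)) ?powR_ge0//.
    rewrite -powRD ?(gt_eqF s0) ?implybT// addrC subrK powRr1//.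
    exact: ltW.
  apply: (@le_trans _ _ (`|phi z| `^ p)); last by rewrite lerDl ltW.
  rewrite -[leRHS]mulr_powRB1// ler_wpM2l//.
  have -> : s `^ (1 - p^-1) = (s `^ p^-1) `^ (p - 1).
    by rewrite -powRrM; congr (_ `^ _); field; rewrite gt_eqF.
  by rewrite ge0_ler_powR ?nnegrE ?powR_ge0 ?subr_ge0// ltW.
- exact: rintegrableD.
Qed.

(* The second component is carried along so that no choice of representatives
   of the weak integrals is needed. *)
Definition selection (au : (Om -> R) * V) := [/\ measurable_fun D au.1,
  forall z, D z -> subdiff (f z) (w z) (au.1 z) & weak_int au.1 au.2].

Lemma selection_le au z : selection au -> D z -> `|au.1 z| <= c * kappa z.
Proof.
move=> [_ sa _] Dz; apply: subdiff_growth (sa z Dz) => //.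
- exact: A_ge0.
- by move=> x; exact: f_ge0.
- by move=> x; exact: f_growth.
Qed.

Lemma dominated_phi a : measurable_fun D a ->
  (forall z, D z -> `|a z| <= c * kappa z) ->
  rintegrable mu D (fun z => `|phi z| * `|a z|).
Proof.
move=> ma ac.
apply: (@rintegrable_le _ _ _ _ _ mD _ (fun z => c * (`|phi z| * kappa z))) => //.
- by apply: measurable_funM => //; exact: meas_norm.
- by move=> z Dz /=; rewrite normrM !normr_id mulrCA ler_wpM2l// ac.
- by apply: rintegrableZ => //; exact: int_phi_envelope.
Qed.

Lemma selection_int au G : selection au -> rintegrable mu D (fun z => ev G z * au.1 z).
Proof.
move=> sau; have [ma _ _] := sau; apply: int_ev_mul => //.
by apply: dominated_phi => // z; exact: selection_le.
Qed.

Lemma selection_ext a : measurable_fun D a ->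
  (forall z, D z -> subdiff (f z) (w z) (a z)) -> exists u, selection (a, u).
Proof.
move=> ma sa.
have ac z : D z -> `|a z| <= c * kappa z.
  move=> Dz; apply: subdiff_growth (sa z Dz) => //.
  - exact: A_ge0.
  - by move=> x; exact: f_ge0.
  - by move=> x; exact: f_growth.
have [u uP] := weak_int_exists ma (dominated_phi ma ac).
by exists u; split.
Qed.

Lemma selection_conv t au au' : 0 <= t <= 1 -> selection au -> selection au' ->
  selection (fun z => t * au.1 z + (1 - t) * au'.1 z, t *: au.2 + (1 - t) *: au'.2).
Proof.
move=> /andP[t0 t1] s s'; have [ma sa ia] := s; have [ma' sa' ia'] := s'; split=> /=.
- by apply: measurable_funD; apply: measurable_funM.
- move=> z Dz x; have := sa z Dz x; have := sa' z Dz x.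
  set y := x - w z; set k := f z (w z) => h1 h2.
  have -> : k + (t * au.1 z + (1 - t) * au'.1 z) * y =
    t * (k + au.1 z * y) + (1 - t) * (k + au'.1 z * y) by ring.
  rewrite [leRHS](_ : _ = t * f z x + (1 - t) * f z x); last by ring.
  by rewrite lerD// ler_wpM2l// subr_ge0.
- move=> G; rewrite hdotDr !hdotZr ia ia' -!rintegralZ//; try exact: selection_int.
  rewrite -rintegralD//; try by apply: rintegrableZ => //; exact: selection_int.
  by apply: eq_Rintegral => z _; ring.
Qed.

(** The subgradient inequality is closed under pointwise limits, and the envelope dominates the
    pairings. The weak integrals converge only weakly, which is all that is used later. *)
Lemma selection_cvg (a : nat -> Om -> R) (u : nat -> V) a' :
  (forall n, selection (a n, u n)) ->
  (forall z, D z -> a n z @[n --> \oo] --> a' z) ->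
  exists2 u', selection (a', u') & forall G, hdot G (u n) @[n --> \oo] --> hdot G u'.
Proof.
move=> sa aa'.
have ma' : measurable_fun D a'.
  by apply: measurable_fun_cvg aa' => n; have [] := sa n.
have [|u' su'] := @selection_ext a' ma'.
  move=> z Dz x.
  have h : f z (w z) + a n z * (x - w z) @[n --> \oo] --> f z (w z) + a' z * (x - w z).
    by apply: cvgD; [exact: cvg_cst|apply: cvgMl; exact: aa'].
  apply: (cvgr_to_le h); apply: nearW => n.
  by have [_ /(_ z Dz x)] := sa n.
exists u' => // G; have [_ _ /= ->] := su'.
have -> : (fun n => hdot G (u n)) = (fun n => \int[mu]_(z in D) (ev G z * a n z)).
  by apply/funext => n; have [_ _ /= ->] := sa n.
have [||||//] := @rintegral_dominated _ Om R mu D mD (fun n z => ev G z * a n z)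
   (fun z => ev G z * a' z) (fun z => `|G| * (c * (`|phi z| * kappa z))).
- by move=> n; apply: measurable_funM => //; have [] := sa n.
- by move=> z Dz; apply: cvgMr; exact: aa'.
- move=> n z Dz; rewrite normrM [leRHS](_ : _ = `|G| * `|phi z| * (c * kappa z));
    last by ring.
  rewrite ler_pM ?hdot_le//.
  exact: (selection_le (sa n) Dz).
- by do 2 apply: rintegrableZ => //; exact: int_phi_envelope.
Qed.

(* The slopes are taken in the direction [1] where [g] vanishes: any subgradient
   will do there. *)
Lemma directional_selection (g : Om -> R) : measurable_fun D g ->
  exists2 au, selection au & forall z, D z ->
    dquot (f z) (w z) (g z) n @[n --> \oo] --> g z * au.1 z.
Proof.
move=> mg; pose h z := if g z == 0 then 1 else g z.
have h0 z : h z != 0 by rewrite /h; case: ifPn => //; rewrite oner_neq0.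
have mh : measurable_fun D h.
  apply: measurable_fun_if => //.
    exact: measurable_fun_eqr.
  by apply: measurable_funS mg => //; exact: subIsetl.
have : forall z, exists x, D z ->
    subdiff (f z) (w z) x /\ dquot (f z) (w z) (h z) n / h z @[n --> \oo] --> x.
  move=> z; have [Dz|nDz] := pselect (D z); last by exists 0.
  by have [x sx hx] := dquot_cvg (w z) (f_cvx Dz) (h0 z); exists x.
move=> /choice[a aP].
have ma : measurable_fun D a.
  apply: (@measurable_fun_cvg _ _ _ _ (fun n z => dquot (f z) (w z) (h z) n / h z)).
    move=> n; apply: measurable_funM; last first.
      (* Expresses the inverse by real powers of [|h|], from which its measurability follows. *)
      have -> : (fun z => (h z)^-1) = (fun z => h z * (`|h z| `^ (-1) * `|h z| `^ (-1))).
        apply/funext => z; rewrite powR_inv1// -invfM -expr2 real_normK ?num_real//.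
        by rewrite expr2 invfM mulVKf.
      by apply: measurable_funM => //; apply: measurable_funM;
        apply: meas_powR; exact: meas_norm.
    apply: measurable_funM => //; apply: measurable_funB; apply: f_meas => //.
    by apply: measurable_funD => //; exact: measurable_funM.
  by move=> z Dz; have [] := aP z Dz.
have [u su] := selection_ext ma (fun z Dz => (aP z Dz).1).
exists (a, u) => //= z Dz.
have [_] := aP z Dz.
rewrite /h; case: eqP => [->|/eqP g0] ha.
  rewrite mul0r (_ : dquot _ _ _ = cst 0); first exact: cvg_cst.
  by apply/funext => n; rewrite /dquot mul0r addr0 subrr mulr0.
rewrite (_ : dquot _ _ _ = fun n => g z * (dquot (f z) (w z) (g z) n / g z)).
  exact: cvgMr.
by apply/funext => n; rewrite mulrCA mulfV// mulr1.
Qed.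

(** The inverse envelope, written as a power for the sake of measurability. *)
Let kinv z := (A z + `|w z| `^ p + 1) `^ (- (1 - p^-1)).

Let kinvE z : D z -> kinv z = (kappa z)^-1.
Proof. by move=> _; rewrite /kinv powRN. Qed.

Let meas_kinv : measurable_fun D kinv.
Proof. exact: meas_powR. Qed.

Let scaled_le au z : selection au -> D z -> `|au.1 z * kinv z| <= c.
Proof.
move=> sau Dz; rewrite kinvE// normrM (gtr0_norm (_ : 0 < _^-1)) ?invr_gt0 ?kappa0//.
by rewrite ler_pdivrMr ?kappa0// selection_le.
Qed.

Let meas_scaled au : selection au -> measurable_fun D (fun z => au.1 z * kinv z).
Proof. by case=> ma _ _; exact: measurable_funM. Qed.

(** The scaled functions are bounded on a set of finite measure, so L1 increments of geometric size
    force convergence almost everywhere; multiplying the envelope back gives the selection. *)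
Lemma selection_fast_cauchy (a : nat -> Om -> R) (u : nat -> V) (K : R) :
  (forall n, selection (a n, u n)) ->
  (forall n, \int[mu]_(z in D) `|a n.+1 z * kinv z - a n z * kinv z| <= K * 2^-1 ^+ n) ->
  exists2 au, selection au & forall G, hdot G (u n) @[n --> \oo] --> hdot G au.2.
Proof.
move=> sa aK.
have [||//|E [mE aeE cE]] := @fast_cauchy_cvg _ Om R mu D mD
  (fun n z => a n z * kinv z) K.
- by move=> n; exact: meas_scaled (sa n).
- move=> n; apply: (@rintegrable_le _ _ _ _ _ mD _ (fun=> c + c)); last exact: int_cst.
    by apply: meas_norm; apply: measurable_funB;
      [exact: meas_scaled (sa n.+1)|exact: meas_scaled (sa n)].
  move=> z Dz; rewrite normr_id (le_trans (ler_normB _ _))// lerD//.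
    exact: scaled_le (sa n.+1) Dz.
  exact: scaled_le (sa n) Dz.
(* Off the convergence set all terms are replaced by the first selection: the limit is then a
   subgradient at every point of [D], and the weak integrals do not change. *)
pose a' n z := if E z then a n z else a 0%N z.
have sa' n : selection (a' n, u n).
  have [ma0 da0 _] := sa 0%N; have [man dan ian] := sa n; split => /=.
  - by apply: measurable_fun_if => //;
      [apply: measurable_funS man|apply: measurable_funS ma0] => //; exact: subIsetl.
  - by move=> z Dz; rewrite /a'; case: ifP => _; [exact: dan|exact: da0].
  - have ma' : measurable_fun D (a' n).
      by apply: measurable_fun_if => //;
        [apply: measurable_funS man|apply: measurable_funS ma0] => //; exact: subIsetl.
    move=> G; rewrite ian; apply: eq_Rintegral_ae => //.
    + exact: measurable_funM.
    + exact: measurable_funM.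
    + by apply: filterS aeE => z Ez Dz; rewrite /a' Ez.
have [z Dz|u'' sau hu] := @selection_cvg a' u (fun z => limn (a' ^~ z)) sa'.
  have [Ez|/negbTE Ez] := boolP (E z).
    have -> : (fun n => a' n z) = (fun n => kappa z * (a n z * kinv z)).
      apply/funext => n; rewrite /a' Ez kinvE// mulrC divfK// gt_eqF// kappa0//.
    by apply: is_cvgMr; exact: cE.
  have -> : (fun n => a' n z) = cst (a 0%N z) by apply/funext => n; rewrite /a' Ez.
  exact: is_cvg_cst.
by exists (fun z => limn (a' ^~ z), u'').
Qed.

(* The infimum is attained without weak compactness: among near-minimisers those
   of nearly minimal L2 norm (after division by the envelope) are L2-Cauchy, so
   a subsequence converges almost everywhere. *)
Lemma selection_closest v : exists2 au, selection au &
  forall au', selection au' -> `|v - au.2| ^+ 2 <= `|v - au'.2| ^+ 2.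
Proof.
pose dist (au : (Om -> R) * V) : R := `|v - au.2| ^+ 2.
pose q (au : (Om -> R) * V) := \int[mu]_(z in D) ((au.1 z * kinv z) ^+ 2).
pose mid (x y : (Om -> R) * V) : (Om -> R) * V :=
  (fun z => 2^-1 * x.1 z + (1 - 2^-1) * y.1 z, 2^-1 *: x.2 + (1 - 2^-1) *: y.2).
have half : 1 - 2^-1 = 2^-1 :> R by field.
have half2 : 2^-1 + 2^-1 = 1 :> R by field.
pose d0 := inf (dist @` selection).
have d0lb : has_lbound (dist @` selection).
  by exists 0 => _ [x _ <-]; exact: exprn_ge0.
(* The zero direction is used only to produce some selection. *)
have [x0 sx0 _] := @directional_selection (cst 0) (measurable_cst _).
have d0ne : (dist @` selection) !=set0 by exists (dist x0), x0.
pose C (n : nat) := [set x | selection x /\ dist x <= d0 + n.+1%:R^-1].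
have smid x y : selection x -> selection y -> selection (mid x y).
  by move=> sx sy; apply: selection_conv => //; rewrite invr_ge0 ler0n invf_le1// ler1n.
have int_sq x y : selection x -> selection y ->
    rintegrable mu D (fun z => (x.1 z * kinv z - y.1 z * kinv z) ^+ 2).
  move=> sx sy; apply: (@rintegrable_le _ _ _ _ _ mD _ (fun=> (c + c) ^+ 2));
    last exact: int_cst.
    by apply: measurable_funX; apply: measurable_funB; exact: meas_scaled.
  move=> z Dz; rewrite normrX ler_pXn2r ?nnegrE ?(addr_ge0 (ltW c0) (ltW c0))//.
  by rewrite (le_trans (ler_normB _ _))// lerD// scaled_le.
have int_sc x : selection x -> rintegrable mu D (fun z => x.1 z * kinv z).
  move=> sx; apply: (@rintegrable_le _ _ _ _ _ mD _ (fun=> c)); last exact: int_cst.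
    exact: meas_scaled.
  by move=> z Dz; exact: scaled_le.
have int_sq1 x : selection x -> rintegrable mu D (fun z => (x.1 z * kinv z) ^+ 2).
  move=> sx; apply: (@rintegrable_le _ _ _ _ _ mD _ (fun=> c ^+ 2)); last exact: int_cst.
    by apply: measurable_funX; exact: meas_scaled.
  by move=> z Dz; rewrite normrX ler_pXn2r ?nnegrE ?(ltW c0)// scaled_le.
have gapE x y : selection x -> selection y ->
    midgap q mid x y = \int[mu]_(z in D) ((x.1 z * kinv z - y.1 z * kinv z) ^+ 2).
  move=> sx sy; have smxy := smid _ _ sx sy.
  rewrite /midgap /q -!rintegralZ//; try exact: int_sq1.
  rewrite -rintegralD//; try by apply: rintegrableZ => //; exact: int_sq1.
  rewrite -rintegralB//; last 2 first.
    by apply: rintegrableD => //; apply: rintegrableZ => //; exact: int_sq1.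
    by apply: rintegrableZ => //; exact: int_sq1.
  by apply: eq_Rintegral => z _ /=; field.
have [|||n|x [xC _ xgap]] := @near_minimizers R _ q mid C 0 (c ^+ 2 * fine (mu D)).
- move=> n m nm x [sx dx]; split => //; rewrite (le_trans dx)// lerD2l.
  by rewrite lef_pV2 ?posrE ?ltr0n// ler_nat.
- move=> n x y [sx dx] [sy dy]; split; first exact: smid.
  rewrite /dist /mid/= half.
  have -> : v - (2^-1 *: x.2 + 2^-1 *: y.2) = 2^-1 *: ((v - x.2) + (v - y.2)).
    rewrite addrACA -opprD scalerBr scalerDr scalerDr -scalerDl.
    by rewrite half2 scale1r.
  have := sqr_ge0 `|(v - x.2) - (v - y.2)|; rewrite parallelogram.
  move: dx dy; rewrite /dist/=; move: (`|v - x.2| ^+ 2) (`|v - y.2| ^+ 2).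
  move: (`|2^-1 *: _| ^+ 2).
  by move: (n.+1%:R^-1) => h *; lra.
- by move=> x _; apply: Rintegral_ge0 => z _; exact: sqr_ge0.
- have [_ [x sx <-] dx] : exists2 e, (dist @` selection) e & e < d0 + n.+1%:R^-1.
    by apply: inf_adherent; [rewrite invr_gt0|split].
  exists x; first by split => //; exact: ltW.
  rewrite -Rintegral_cst//; apply: rintegral_le => //; first exact: int_sq1.
  by move=> z Dz; rewrite -real_normK ?num_real// ler_pXn2r ?nnegrE ?(ltW c0)// scaled_le.
have sx n : selection (x n) by have [] := xC n.
have /choice[N NP] : forall k : nat, exists N, forall n m, (N <= n)%N -> (N <= m)%N ->
    midgap q mid (x n) (x m) < (2^-1 ^+ k) ^+ 2.
  by move=> k; apply: xgap; rewrite !exprn_gt0.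
(* These indices dominate both [N k] and [k] and increase, so [s k] and [s k.+1] lie beyond
   [N k]. *)
pose s k := (\sum_(j < k.+1) (N j).+1)%N.
have sS k : s k.+1 = (s k + (N k.+1).+1)%N by rewrite /s big_ord_recr.
have sN k : (N k <= s k)%N.
  by rewrite /s big_ord_recr/= addnS ltnW// ltnS leq_addl.
have sk k : (k <= s k)%N.
  by elim: k => // k IH; rewrite sS addnS ltnS (leq_trans IH)// leq_addr.
have [||au sau hau] := @selection_fast_cauchy (fun k => (x (s k)).1)
    (fun k => (x (s k)).2) ((1 + fine (mu D)) / 2).
- by move=> n; have := sx (s n); case: (x (s n)).
- move=> k; set e := 2^-1 ^+ k.
  have e0 : 0 < e by rewrite exprn_gt0.
  have := NP k (s k.+1) (s k) (leq_trans (sN k) _) (sN k).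
  rewrite sS leq_addr => /(_ isT); rewrite -sS gapE// -/e => hgap.
  set Q := \int[mu]_(z in D) _ in hgap.
  (* By [|y| <= y^2 / (2 e) + e / 2], the L2 bound [e^2] becomes an L1 bound of order [e], which is
     geometric; this gives the constant [(1 + mu D) / 2]. *)
  apply: (@le_trans _ _ ((2 * e)^-1 * Q + e / 2 * fine (mu D))); last first.
    have -> : (1 + fine (mu D)) / 2 * e = (2 * e)^-1 * e ^+ 2 + e / 2 * fine (mu D).
      by field; rewrite gt_eqF.
    by rewrite lerD2r ler_wpM2l ?ltW// invr_gt0 mulr_gt0.
  rewrite -rintegralZ//; last exact: int_sq.
  rewrite -Rintegral_cst// -rintegralD//; last by apply: rintegrableZ => //; exact: int_sq.
  apply: rintegral_le => //.
  + by apply: rintegrable_norm => //; apply: rintegrableB => //; exact: int_sc.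
  + by apply: rintegrableD => //; apply: rintegrableZ => //; exact: int_sq.
  + move=> z Dz; set y := _ - _.
    rewrite -subr_ge0 (_ : _ - _ = (2 * e)^-1 * (`|y| - e) ^+ 2).
      by rewrite mulr_ge0 ?sqr_ge0// invr_ge0 mulr_ge0// ltW.
    by rewrite -[in y ^+ 2](real_normK (num_real y)); field; rewrite gt_eqF.
exists au => // au' sau'.
have d0le : d0 <= `|v - au'.2| ^+ 2 by apply: ge_inf => //; exists au'.
apply: le_trans d0le.
set G := v - au.2.
(* Weak lower semicontinuity of the norm: bound [<G, v - u_n>] by half of [|G|^2 + |v - u_n|^2] and
   pass to the limit to get [|G|^2 <= d0]. *)
have lim1 : hdot G (v - (x (s n)).2) @[n --> \oo] --> `|G| ^+ 2.
  rewrite (_ : `|G| ^+ 2 = hdot G v - hdot G au.2); last by rewrite -hdotE -hdotBr.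
  under eq_fun do rewrite hdotBr.
  by apply: cvgB; [exact: cvg_cst|exact: hau].
have : `|G| ^+ 2 <= 2^-1 * (`|G| ^+ 2 + d0); last by lra.
have lim2 : 2^-1 * (`|G| ^+ 2 + (d0 + n.+1%:R^-1)) @[n --> \oo] -->
   2^-1 * (`|G| ^+ 2 + (d0 + 0)).
  by apply: cvgMr; apply: cvgD; first exact: cvg_cst;
    apply: cvgD; [exact: cvg_cst|exact: cvg_harmonic].
rewrite addr0 in lim2.
apply: (ler_cvg_to lim1 lim2); apply: nearW => n.
rewrite (le_trans (ler_norm _))// (le_trans (hdot_le _ _))//.
have [_ dx] := xC (s n).
have : dist (x (s n)) <= d0 + n.+1%:R^-1.
  rewrite (le_trans dx)// lerD2l lef_pV2 ?posrE ?ltr0n// ler_nat ltnS.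
  exact: sk.
rewrite /dist/=; have := sqr_ge0 (`|G| - `|v - (x (s n)).2|).
move: (`|G|) (`|v - (x (s n)).2|) (n.+1%:R^-1) => X Y h.
rewrite sqrrB => h1 h2.
by nra.
Qed.

End Subgradients.
(* Take the selection whose weak integral is closest to [- lambda F], and let [G]
   be the difference; compare it with the selection realising the directional
   derivative of the risk along [G]. *)
Lemma risk_minimizer_selection F lambda : 0 < lambda ->
  (forall F', \int[mu]_(z in D) f z (ev F z) + lambda / 2 * `|F| ^+ 2 <=
     \int[mu]_(z in D) f z (ev F' z) + lambda / 2 * `|F'| ^+ 2) ->
  exists2 au, selection (fun z => ev F z) au & au.2 = - (lambda *: F).
Proof.
move=> l0 Fmin; pose w z := ev F z; pose v := - (lambda *: F).
have mw : measurable_fun D w by exact: meas_ev.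
have Iw : rintegrable mu D (fun z => `|w z| `^ p) by exact: int_ev_powR.
have [au sau aumin] := selection_closest mw Iw v.
exists au => //; pose G := v - au.2.
have [au' sau' dau'] := directional_selection mw Iw (meas_ev G).
have uu' : hdot G (au'.2 - au.2) <= 0.
  rewrite leNgt; apply/negP; set del := hdot G _ => del0.
  set nn := `|au'.2 - au.2| ^+ 2.
  have nn0 : 0 <= nn by exact: exprn_ge0.
  (* If [del > 0], moving from [au.2] towards [au'.2] by this fraction strictly decreases the
     distance to [v]; the denominator keeps [t] at most 1. *)
  pose t := del / (del + nn).
  have s0 : 0 < del + nn by rewrite ltr_pwDl.
  have t01 : 0 <= t <= 1.
    by rewrite divr_ge0 ?(ltW del0) ?(ltW s0)//= ler_pdivrMr// mul1r lerDl.
  have := aumin _ (selection_conv mw Iw t01 sau' sau); rewrite /= -/G.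
  have -> : v - (t *: au'.2 + (1 - t) *: au.2) = G + (- t) *: (au'.2 - au.2).
    by rewrite scalerBl scale1r addrCA opprD addrA scaleNr scalerBr.
  rewrite hnorm_addZ -/del -/nn -subr_ge0.
  have E (X x y : R) : 0 < x + y ->
      X + 2 * - (x / (x + y)) * x + (- (x / (x + y))) ^+ 2 * y - X =
      - (x ^+ 2 * (2 * x + y)) / (x + y) ^+ 2 by move=> xy; field; rewrite gt_eqF.
  rewrite /t E//.
  rewrite pmulr_lge0 ?invr_gt0 ?exprn_gt0// oppr_ge0 leNgt.
  by rewrite mulr_gt0 ?exprn_gt0// ltr_wpDr// mulr_gt0.
have vu' : hdot G v <= hdot G au'.2.
  have [_ _ ->] := sau'.
  have Fn n z : ev (F + n.+1%:R^-1 *: G) z = w z + ev G z / n.+1%:R.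
    by rewrite hdotDl hdotZl mulrC.
  (* By convexity the quotients lie between the increments at [F - G] and [F + G]; as the loss is
     nonnegative, the sum of the three values dominates them. *)
  have [||||_ cv] := @rintegral_dominated _ Om R mu D mD
      (fun n z => dquot (f z) (w z) (ev G z) n) (fun z => ev G z * au'.1 z)
      (fun z => f z (ev (F + G) z) + f z (ev F z) + f z (ev (F - G) z)).
  - move=> n; apply: measurable_funM => //; apply: measurable_funB; apply: f_meas => //.
    by apply: measurable_funD => //; exact: measurable_funM.
  - exact: dau'.
  - move=> n z Dz.
    have := dquot_le (w z) (ev G z) (f_cvx Dz) n.
    have := dquot_ge (w z) (ev G z) (f_cvx Dz) n.
    rewrite hdotDl hdotBl -/(w z).
    have := f_ge0 (w z) Dz; have := f_ge0 (w z + ev G z) Dz.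
    have := f_ge0 (w z - ev G z) Dz.
    by rewrite ler_norml => *; apply/andP; split; lra.
  - by apply: rintegrableD => //; [apply: rintegrableD => //|]; exact: int_risk.
  (* Minimality at [F + G / (n+1)] bounds the quotient of the risk below by [<G, v>] up to the
     quadratic part of the penalty, which vanishes in the limit. *)
  have cl : hdot G v - lambda / 2 * `|G| ^+ 2 * n.+1%:R^-1 @[n --> \oo] -->
      hdot G v - lambda / 2 * `|G| ^+ 2 * 0.
    by apply: cvgB; [exact: cvg_cst|apply: cvgMr; exact: cvg_harmonic].
  rewrite mulr0 subr0 in cl.
  apply: (ler_cvg_to cl cv); apply: nearW => n.
  rewrite (_ : \int[mu]_(z in D) _ = n.+1%:R *
    (\int[mu]_(z in D) f z (ev (F + n.+1%:R^-1 *: G) z) -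
     \int[mu]_(z in D) f z (ev F z))); last first.
    rewrite -rintegralB//; try exact: int_risk.
    rewrite -rintegralZ//; last by apply: rintegrableB => //; exact: int_risk.
    by apply: eq_Rintegral => z _; rewrite /dquot Fn.
  have := Fmin (F + n.+1%:R^-1 *: G); rewrite hnorm_addZ.
  rewrite {1}/v hdotNr hdotZr (hdotC G F).
  move: (\int[mu]_(z in D) _) (\int[mu]_(z in D) _) => I1 I2.
  move: (`|F| ^+ 2) (`|G| ^+ 2) (hdot F G) => X Y Z.
  have N0 : 0 < n.+1%:R :> R by rewrite ltr0n.
  move: (n.+1%:R) N0 => N N0 h.
  have -> : - (lambda * Z) - lambda / 2 * Y / N =
    N * (lambda / 2 * X - lambda / 2 * (X + 2 * N^-1 * Z + N^-1 ^+ 2 * Y)).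
    by field; rewrite gt_eqF.
  by rewrite ler_pM2l//; lra.
have : `|G| ^+ 2 <= 0.
  have GE : hdot G G = hdot G v - hdot G au.2 by rewrite -hdotBr.
  rewrite -hdotE GE; move: uu'; rewrite hdotBr.
  by move: vu'; lra.
by rewrite real_exprn_even_le0//= normr_eq0 subr_eq0 => /eqP.
Qed.

Lemma subgradient_risk_minimizer F a lambda : 0 < lambda -> measurable_fun D a ->
  rintegrable mu D (fun z => `|phi z| * `|a z|) ->
  {ae mu, forall z, D z -> subdiff (f z) (ev F z) (a z)} ->
  weak_int a (- (lambda *: F)) ->
  forall F', \int[mu]_(z in D) f z (ev F z) + lambda / 2 * `|F| ^+ 2 <=
    \int[mu]_(z in D) f z (ev F' z) + lambda / 2 * `|F'| ^+ 2.
Proof.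
move=> l0 ma Ia da wa F'.
have Iev := int_ev_mul (F' - F) ma Ia.
have If : rintegrable mu D (fun z => f z (ev F' z) - f z (ev F z)).
  by apply: rintegrableB => //; exact: int_risk.
have : 0 <= \int[mu]_(z in D)
    ((f z (ev F' z) - f z (ev F z)) - ev (F' - F) z * a z).
  apply: rintegral_ae_ge0 => //; first by apply: rintegrableB.
  apply: filterS da => z sz Dz; have := sz Dz (ev F' z).
  by rewrite hdotBl; nra.
rewrite rintegralB// rintegralB//; try exact: int_risk.
rewrite -wa hdotNr hdotZr hdotBl -!hdotE => h.
(* The square gives [|F'|^2 - |F|^2 >= 2 <F, F' - F>], which absorbs the pairing left by the weak
   integral. *)
have := sqr_ge0 `|F' - F|; rewrite -hdotE hdotBl !hdotBr (hdotC F F').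
move: h l0; move: (\int[mu]_(z in D) _) (\int[mu]_(z in D) _) => I1 I2.
move: (hdot F' F) (hdot F F) (hdot F' F') => x y z.
by nra.
Qed.

End RegularizedRisk.

(** * Conjugate exponents and membership in L^q *)

Section ConjugateExponents.
Context d (Om : measurableType d) {R : realType}.
Context (mu : {measure set Om -> \bar R}) (D : set Om).
Hypothesis mD : measurable D.
Context (p : R) (q : \bar R).
Hypothesis p1 : 1 <= p.
Hypothesis pq : (p%:E^-1 + q^-1 = 1)%E.

(** In extended reals 0 and the infinities are mutually handled by the inverse: [q = 0] and
    [q = -oo] make the sum infinite, and [q = +oo] contributes 0. *)
Lemma conjugate_exponentP :
  (exists r, [/\ q = r%:E, 0 < r & p^-1 + r^-1 = 1]) \/ q = +oo%E /\ p = 1.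
Proof.
have p0 : 0 < p by exact: lt_le_trans p1.
move: pq; rewrite inver gt_eqF//; case: q => [r| |].
- rewrite inver; case: eqP => [_|/eqP r0]; first by rewrite addey.
  move=> /= -[pr]; left; exists r; split => //.
  have : 0 <= r^-1 by rewrite -[r^-1](addKr p^-1) pr addrC subr_ge0 invf_le1.
  by rewrite invr_ge0 le_eqVlt eq_sym (negbTE r0).
- rewrite invey adde0 => -[/eqP]; rewrite invr_eq1 => /eqP ->.
  by right.
- by rewrite inveNy addeNy.
Qed.

(** Young's inequality pointwise when [q] is finite, an essential bound on [a] when it is
    infinite. *)
Lemma Lfun_mul_integrable (g a : Om -> R) :
  measurable_fun D g -> rintegrable mu D (fun z => `|g z| `^ p) ->
  a \in Lfun mu q -> rintegrable mu D (fun z => `|g z| * `|a z|).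
Proof.
move=> mg Ig; rewrite inE => /andP[/[!inE]/= mTa fa].
have ma : measurable_fun D a by exact: measurable_funTS.
have mga : measurable_fun D (fun z => `|g z| * `|a z|).
  by apply: measurable_funM; exact: measurableT_comp.
have p0 : 0 < p by exact: lt_le_trans p1.
case: conjugate_exponentP => [[r [qr r0 pr]]|[qy pE]].
  have r1 : 1 <= r.
    have : r^-1 <= 1 by rewrite -pr lerDr invr_ge0 ltW.
    by rewrite invf_le1.
  have Ia : rintegrable mu D (fun z => `|a z| `^ r).
    have : a \in Lfun mu r%:E by rewrite -qr inE; apply/andP; split; rewrite inE.
    by move=> /(Lfun_integrable r1); exact: integrableS.
  apply: (@rintegrable_le _ _ _ _ _ mD _
    (fun z => p^-1 * `|g z| `^ p + r^-1 * `|a z| `^ r)) => //.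
    move=> z Dz; rewrite ger0_norm ?mulr_ge0// ![_^-1 * _]mulrC.
    exact: conjugate_powR.
  by apply: rintegrableD => //; exact: rintegrableZ.
have [M aM] : exists M, {ae mu, forall z, `|a z| <= M}.
  move: fa; rewrite /finite_norm qy unlock.
  case: ifPn => [_|]; first exact: (@ess_supr_bounded _ _ _ mu (fun z => `|a z|)).
  (* For the zero measure the L^oo norm is 0 by convention, and every bound holds almost
     everywhere. *)
  rewrite -leNgt => mu0 _; exists 0; exists setT; split => //.
  by apply/eqP; rewrite eq_le mu0/=.
apply: (@rintegrable_ae_le _ _ _ _ _ mD _ (fun z => M * `|g z| `^ p)) => //.
  apply: filterS aM => z aM Dz; rewrite ger0_norm ?mulr_ge0// mulrC pE powRr1//.
  by rewrite ler_wpM2r.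
exact: rintegrableZ.
Qed.

(** For finite [q] the exponent satisfies [(1 - 1/p) q = 1], so [|a|^q] is at most [c^q s]; for
    [p = 1] it is 0 and [a] is bounded by [c]. Vanishing off [D] matters because [Lfun] integrates
    over the whole space. *)
Lemma envelope_Lfun (a s : Om -> R) c : 0 <= c ->
  measurable_fun [set: Om] a -> (forall z, ~ D z -> a z = 0) ->
  (forall z, D z -> 0 <= s z) -> rintegrable mu D s ->
  (forall z, D z -> `|a z| <= c * s z `^ (1 - p^-1)) -> a \in Lfun mu q.
Proof.
move=> c0 ma aD s0 Is ac; rewrite inE; apply/andP; split; rewrite inE//=.
rewrite /finite_norm unlock.
case: conjugate_exponentP => [[r [-> r0 pr]]|[-> pE]]; last first.
  case: ifPn => // _; apply: (@le_lt_trans _ _ c%:E); last exact: ltry.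
  apply: ess_sup_ler => z; rewrite lee_fin.
  have [Dz|nDz] := pselect (D z); last by rewrite aD// normr0.
  by rewrite (le_trans (ac z Dz))// pE invr1 subrr powRr0 mulr1.
apply: poweR_lty.
have -> : (\int[mu]_z `|(EFin \o a) z| `^ r = \int[mu]_(z in D) (`|a z| `^ r)%:E)%E.
  rewrite [RHS]integral_mkcond; apply: eq_integral => z _.
  rewrite /patch; case: ifPn => //= nDz.
  rewrite aD ?normr0 ?powR0 ?gt_eqF//.
  by move=> Dz; move/negP: nDz; apply; rewrite inE.
have Ica : rintegrable mu D (fun z => `|a z| `^ r).
  apply: (@rintegrable_le _ _ _ _ _ mD _ (fun z => c `^ r * s z)).
  - apply: (measurableT_comp (measurable_powR r)).
    by apply: measurableT_comp => //; exact: measurable_funTS.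
  - move=> z Dz; rewrite ger0_norm ?powR_ge0//.
    have -> : c `^ r * s z = (c * s z `^ (1 - p^-1)) `^ r.
      rewrite powRM ?powR_ge0// -powRrM.
      have -> : (1 - p^-1) * r = 1 by rewrite -pr addrC addKr mulVf ?gt_eqF.
      by rewrite powRr1// s0.
    rewrite ge0_ler_powR ?nnegrE ?mulr_ge0 ?powR_ge0 ?(ltW r0)//.
    exact: ac.
  - exact: rintegrableZ.
case/integrableP: Ica => _; apply: le_lt_trans.
by under [leRHS]eq_integral do rewrite gee0_abs ?lee_fin ?powR_ge0//.
Qed.

End ConjugateExponents.

(** * Features and their closed span *)

Section Features.
Context {R : realType} {V : hilbertSpace R} {X : Type} (Phi : X -> V).
Implicit Types (F G P u : V).
Local Notation S := (closure (lspan (range Phi))).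

Lemma feature_span_sub x : S (Phi x).
Proof. by apply/subset_closure/sub_lspan; exists x. Qed.

Lemma feature_span0 : S 0.
Proof.
apply: subset_closure; exists 0%N, (fun=> 0), (fun=> 0).
by split; [case|rewrite big_ord0].
Qed.

Lemma feature_projection F : exists2 P, S P & forall G, S G -> hdot G (F - P) = 0.
Proof.
apply: hilbert_projection; first exact: closed_closure.
- exact: feature_span0.
- by move=> a G K; exact: closure_lspan_add.
Qed.

Lemma feature_span_eq F G : S F -> S G ->
  (forall x, hdot F (Phi x) = hdot G (Phi x)) -> F = G.
Proof.
move=> SF SG FG; apply/eqP; rewrite -subr_eq0 -normr_eq0 -sqrf_eq0 -hdotE.
apply/eqP/(@closure_lspan_ortho _ _ (range Phi)).
  by rewrite addrC -scaleN1r; exact: closure_lspan_add.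
by move=> _ [x _ <-]; rewrite hdotBl FG subrr.
Qed.

Lemma argmin_feature_span (J : V -> \bar R) (risk : V -> R) lambda : 0 < lambda ->
  (forall F, J F = (risk F + lambda / 2 * `|F| ^+ 2)%:E) ->
  (forall F G, (forall x, hdot F (Phi x) = hdot G (Phi x)) -> risk F = risk G) ->
  argmin setT J = argmin S J.
Proof.
move=> l0 JE Iext.
have projE F P : S P -> (forall G, S G -> hdot G (F - P) = 0) ->
    risk P = risk F /\ `|F| ^+ 2 = `|P| ^+ 2 + `|F - P| ^+ 2.
  move=> SP PF; split.
    apply: Iext => x; apply/eqP; rewrite eq_sym -subr_eq0 -hdotBl hdotC.
    by rewrite PF//; exact: feature_span_sub.
  have := hnorm_addZ P (F - P) 1.
  by rewrite PF// mulr0 addr0 expr1n mul1r scale1r addrC subrK.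
apply/seteqP; split => [F [_ Fmin]|F [SF Fmin]].
  split; last by move=> F' _; exact: Fmin.
  have [P SP PF] := feature_projection F.
  have [IP NP] := projE _ _ SP PF.
  have := Fmin P Logic.I; rewrite !JE lee_fin IP NP => h.
  have : `|F - P| ^+ 2 <= 0 by move: h; nra.
  by rewrite real_exprn_even_le0//= normr_eq0 subr_eq0 => /eqP ->.
split=> // F' _.
have [P SP PF] := feature_projection F'.
have [IP NP] := projE _ _ SP PF.
rewrite (le_trans (Fmin P SP))// !JE lee_fin IP NP lerD2l.
by rewrite ler_wpM2l ?lerDl ?exprn_ge0// divr_ge0// ltW.
Qed.

End Features.

Section MeasurableFeatures.
Context {R : realType} {V : hilbertSpace R}.
Context d (X : measurableType d) (Phi : X -> V).
Hypothesis meas_kernel : measurable_fun [set: X * X]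
  (fun z : X * X => hdot (Phi z.1) (Phi z.2)).

(** Replacing [F] by its projection changes no pairing with [Phi]; the projection is a limit of
    combinations of the [Phi y], whose pairings are sections of the kernel. *)
Lemma measurable_feature F : measurable_fun [set: X] (fun x => hdot F (Phi x)).
Proof.
have [P SP PF] := feature_projection Phi F.
have -> : (fun x => hdot F (Phi x)) = (fun x => hdot P (Phi x)).
  apply/funext => x; apply/eqP; rewrite -subr_eq0 -hdotBl hdotC.
  by rewrite PF//; exact: feature_span_sub.
have [u uS uP] := closure_seq SP.
apply: (@measurable_fun_cvg _ _ _ _ (fun n x => hdot (u n) (Phi x))).
  move=> n; have [k [c [w [wP ->]]]] := uS n.
  under eq_fun do rewrite hdot_suml.
  apply: measurable_sum => i.
  have [y _ yw] := wP i.
  under eq_fun do rewrite hdotZl -yw.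
  by apply: measurable_funM => //; exact: measurable_fun_pair2 meas_kernel.
move=> x _; rewrite hdotC; under eq_fun do rewrite hdotC.
exact: hdot_cvgr uP.
Qed.

Lemma measurable_feature_norm : measurable_fun [set: X] (fun x => `|Phi x|).
Proof.
have -> : (fun x => `|Phi x|) = (fun x => hdot (Phi x) (Phi x) `^ 2^-1).
  by apply/funext => x; rewrite hdotE powR12_sqrt ?sqrtr_sqr ?normr_id ?exprn_ge0.
apply: (measurableT_comp (measurable_powR _)).
by apply: (measurableT_comp meas_kernel (measurable_fun_pair _ _)).
Qed.

End MeasurableFeatures.

(** * Application to kernels of rough integrals *)

Theorem theorem5
    (R : realType) (T alpha : R) (T0 : 0 < T) (alpha01 : 0 < alpha < 1)
    (X : ptopologicalType)
    (G : topologicalLmodType R) (psi : X -> path_on G T)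
    (H : vectType R) (dotH : {dot H for idfun})
    (n : nat) (e : n.-tuple H)
    (basis_e : basis_of fullv e) (orthonormal_e : orthonormal dotH e)
    (xi : X -> forall m, R -> R -> tens R n m)
    (xi_rough : forall x, rough_path T alpha (xi x))
    (K : stopped_path G T -> stopped_path G T -> 'End(H))
    (K_kernel : op_kernel dotH K)
    (HK : rkhs dotH K)
    (KK : X -> forall m, R -> {bilinear tens R n m -> H -> HK})
    (KK0 : forall x (s : set_type `[0, T]%classic) v h,
       KK x 0%N (set_val s) v h =
         v [tuple] *: rk_sec HK (path_restrict (psi x) s) h)
    (KK_controlled : forall x, controlled_path dotH T alpha (xi x) (KK x)) :
  let Phi x := rough_int e T alpha (xi x) (KK x) : HK in
  let KPhi x x' := hdot (Phi x) (Phi x') in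
  let HPhi := closure (lspan (range Phi)) in
  let dint (F : HK) x := rough_pair e T alpha (xi x) (KK x) F in
  let ev (F : HK) x := hdot F (Phi x) in
  locally_compact [set: X] -> @second_countable X ->
  measurable_fun [set: borel X * borel X]
    (fun z : borel X * borel X => KPhi z.1 z.2) ->
  forall (Y : set R) (mu : probability (borel X * R)%type R) (p : R) (q : \bar R),
  let XY := [set: borel X] `*` Y in
  closed Y -> mu XY = 1%E ->
  1 <= p -> (p%:E^-1 + q^-1 = 1)%E ->
  (\int[mu]_(z in XY) (KPhi z.1 z.1 `^ (p / 2))%:E < +oo)%E ->
  forall (V : R -> R -> R) (lambda : R), is_loss mu Y p V -> 0 < lambda ->
  let optimal (F : HK) (a : borel X * R -> R) :=
    [/\ a \in Lfun mu q,
        {ae mu, forall z, XY z -> subdiff (V^~ z.2) (ev F z.1) (a z)} &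
        forall x, ev F x = - lambda^-1 * \int[mu]_(z in XY) (KPhi x z.1 * a z)] in
  [/\ argmin [set: HK] (reg_risk mu Y V lambda dint) =
        argmin HPhi (reg_risk mu Y V lambda ev),
      forall F, HPhi F ->
        (argmin HPhi (reg_risk mu Y V lambda ev) F <-> exists a, optimal F a) &
      forall F a, HPhi F -> optimal F a -> forall s z,
        [/\ dotH (rk_fun HK F s) z = hdot F (rk_sec HK s z),
            hdot F (rk_sec HK s z) =
              - lambda^-1 *
              \int[mu]_(w in XY) (hdot (Phi w.1) (rk_sec HK s z) * a w) &
            dotH (rk_fun HK F s) z =
              - lambda^-1 *
              \int[mu]_(w in XY) (a w * dint (rk_sec HK s z) w.1)]].
Proof.
have alpha0 : 0 < alpha by case/andP: alpha01.
move=> Phi KPhi HPhi dint ev _ _ mK Y mu p q XY clY muXY p1 pq intK L lambda hL l0 optimal.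
have p0 : 0 < p by exact: lt_le_trans p1.
have dintE : dint = ev.
  apply/funext => F; apply/funext => x.
  exact: (rough_pairE e T0 alpha0 (xi_rough x) (KK_controlled x)).
have mY : measurable Y by exact: closed_measurable.
have mXY : measurable XY by exact: measurableX.
have muXYy : (mu XY < +oo)%E by rewrite muXY ltry.
pose phi (z : borel X * R) : HK := Phi z.1.
have mev F : measurable_fun XY (fun z => hdot F (phi z)).
  apply: measurable_funTS.
  exact: (measurableT_comp (@measurable_feature R HK _ (borel X) Phi mK F) measurable_fst).
have mphi : measurable_fun XY (fun z => `|phi z|).
  apply: measurable_funTS.
  exact: (measurableT_comp (@measurable_feature_norm R HK _ (borel X) Phi mK) measurable_fst).
have iphi : rintegrable mu XY (fun z => `|phi z| `^ p).
  apply/integrableP; split.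
    by apply/measurable_EFinP; apply: (measurableT_comp (measurable_powR p)).
  apply: le_lt_trans intK; rewrite le_eqVlt; apply/orP; left; apply/eqP.
  apply: eq_integral => z _; rewrite /= ger0_norm ?powR_ge0// /KPhi hdotE.
  congr (_%:E); rewrite -powR_mulrn// -powRrM mulrC divfK//.
have [b [a [b0 a0 La Ia]]] := loss_growth hL.
pose f (z : borel X * R) := L^~ z.2.
have f0 z x : XY z -> 0 <= f z x by move=> [_ Yz]; exact: loss_ge0 hL _ _ Yz.
have fcvx z : XY z -> cvx (f z).
  by move=> [_ Yz]; apply: convex_function_cvx; exact: loss_convex hL _ Yz.
have fm w : measurable_fun XY w -> measurable_fun XY (fun z => f z (w z)).
  (* The loss is measurable only on the product of the line with [Y]. Extending [w] by 0 gives a map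
     measurable everywhere, to be paired with the second coordinate. *)
  move=> mw; pose w' := w \_ XY.
  have mw' : measurable_fun setT w' by exact: (measurable_restrictT _ mXY).1 mw.
  have mwy : measurable_fun XY (fun z : borel X * R => (w' z, z.2)).
    by apply: measurable_funTS; exact: (measurable_fun_pair mw' measurable_snd).
  have : measurable_fun XY ((fun wy : R * R => L wy.1 wy.2) \o
      (fun z : borel X * R => (w' z, z.2))).
    apply: measurable_comp mwy; last exact: loss_measurable hL.
      by apply: measurableX.
    by move=> _ [z [_ Yz] <-].
  by apply: eq_measurable_fun => z zXY; rewrite /= /w' patchT.
have fgrowth z x : XY z -> f z x <= a z.2 + b * `|x| `^ p.
  by move=> [_ Yz]; exact: La.
have ma0 (z : borel X * R) : XY z -> 0 <= a z.2 by move=> [_ Yz]; exact: a0.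
have Ia' : rintegrable mu XY (fun z => a z.2) by exact: Ia.
pose risk F := \int[mu]_(z in XY) f z (hdot F (phi z)).
have Irisk F : rintegrable mu XY (fun z => f z (hdot F (phi z))).
  exact: (int_risk mXY p1 mev iphi f0 fm Ia' fgrowth).
have JE F : reg_risk mu Y L lambda ev F = (risk F + lambda / 2 * `|F| ^+ 2)%:E.
  rewrite /reg_risk EFinD; congr (_ + _)%E.
  by rewrite /risk /Rintegral fineK//; exact: (integrable_fin_num mXY (Irisk F)).
have argminE : argmin setT (reg_risk mu Y L lambda ev) =
    argmin HPhi (reg_risk mu Y L lambda ev).
  apply: (argmin_feature_span l0 JE) => F F1 FF1.
  by apply: eq_Rintegral => z _; rewrite FF1.
have LfunP al : al \in Lfun mu q -> measurable_fun XY al /\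
    rintegrable mu XY (fun z => `|phi z| * `|al z|).
  move=> aq; split; last first.
    rewrite -[X in rintegrable _ _ X](_ : (fun z => `| `|phi z| | * `|al z|) = _).
      apply: (Lfun_mul_integrable mXY p1 pq mphi _ aq).
      by under eq_fun do rewrite normr_id.
    by apply/funext => z; rewrite normr_id.
  by apply: measurable_funTS; move: aq; rewrite inE => /andP[/[!inE]].
(* The optimality equation tests the weak integral [u] only against the [Phi x]. This determines it
   because [u] lies in their closed span: [u - P] is orthogonal to every [Phi x], hence to [u], and
   it is also orthogonal to [P]. *)
have optimal_weak_int F al : HPhi F -> optimal F al ->
    weak_int mu XY phi al (- (lambda *: F)).
  move=> SF [/LfunP[mA IA] _ evF].
  have [u wu] := weak_int_exists mXY mev mA IA.
  have [P SP PF] := feature_projection Phi u.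
  have uP0 : hdot (u - P) u = 0.
    rewrite wu; under eq_Rintegral.
      move=> z _; rewrite hdotC PF ?mul0r; last exact: feature_span_sub.
      over.
    by rewrite Rintegral_cst// mul0r.
  have uP : u = P.
    apply/eqP; rewrite -subr_eq0 -normr_eq0 -sqrf_eq0 -hdotE.
    by rewrite hdotBr uP0 hdotC PF// subrr.
  suff -> : F = - lambda^-1 *: u by rewrite scalerA mulrN mulfV ?gt_eqF// scaleN1r opprK.
  apply: (feature_span_eq SF).
    rewrite uP -[_ *: P]addr0; apply: closure_lspan_add => //.
    exact: feature_span0.
  move=> x; rewrite hdotZl (hdotC u) wu.
  exact: evF.
rewrite dintE; split => //.
- move=> F SF; split=> [Fmin|[al oa]].
    (* Minimality is transferred to all of [HK], since the direction in which [F] is perturbed is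
       not known to lie in [HPhi]. *)
    have Fmin' F' : risk F + lambda / 2 * `|F| ^+ 2 <= risk F' + lambda / 2 * `|F'| ^+ 2.
      move: Fmin; rewrite -argminE => -[_ /(_ F' Logic.I)].
      by rewrite !JE lee_fin.
    have [[al u] sel /= uE] := risk_minimizer_selection mXY muXYy p1 b0 mev mphi iphi
      f0 fcvx fm ma0 Ia' fgrowth l0 Fmin'.
    have [ma1 da wa] := sel.
    have ale z := selection_le p1 b0 f0 ma0 fgrowth sel (z := z).
    (* The selection is controlled only on [XY]; it is set to 0 elsewhere to lie in L^q over the
       whole space. *)
    exists (al \_ XY); split.
    + apply: (envelope_Lfun mXY p1 pq (c := 1 + b * 2 `^ p)
        (s := fun z => a z.2 + `|hdot F (phi z)| `^ p + 1)).
      * by rewrite addr_ge0 ?mulr_ge0 ?powR_ge0.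
      * exact: (measurable_restrictT _ mXY).1 ma1.
      * by move=> z nz; rewrite patchC// inE.
      * by move=> z Dz; rewrite !addr_ge0 ?powR_ge0// ma0.
      * apply: rintegrableD => //.
          by apply: rintegrableD => //; exact: (int_ev_powR mXY p1 mev iphi).
        exact: rintegrable_cst.
      * by move=> z Dz; rewrite patchT ?inE//; exact: ale.
    + by apply: aeW => z Dz; rewrite patchT ?inE//; exact: da.
    + move=> x; rewrite (_ : \int[mu]_(z in XY) _ = hdot (Phi x) (- (lambda *: F))).
        by rewrite hdotNr hdotZr mulNr mulrN opprK mulKf ?gt_eqF// hdotC.
      rewrite -uE wa; apply: eq_Rintegral => z zD.
      by rewrite patchT.
  rewrite -argminE; split => // F' _; rewrite !JE lee_fin.
  have [aq sa _] := oa; have [mA IA] := LfunP _ aq.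
  exact: (subgradient_risk_minimizer mXY p1 mev iphi f0 fm Ia' fgrowth l0 mA IA sa
    (optimal_weak_int _ _ SF oa)).
- move=> F al SF oa s z.
  have E : hdot F (rk_sec HK s z) =
      - lambda^-1 * \int[mu]_(w in XY) (hdot (Phi w.1) (rk_sec HK s z) * al w).
    (* The weak integral identity holds against every vector of [HK], in particular against kernel
       sections outside [HPhi]. *)
    have := optimal_weak_int _ _ SF oa (rk_sec HK s z).
    rewrite hdotNr hdotZr hdotC => h.
    under eq_Rintegral do rewrite hdotC.
    by rewrite -h mulNr mulrN opprK mulKf// gt_eqF.
  rewrite -rk_repr; split => //; rewrite E; congr (_ * _).
  by apply: eq_Rintegral => w _; rewrite mulrC hdotC.
Qed.
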